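(* The $k$-RCW verification problem is NP-hard. Here the problem takes as input a configuration $C=(G,G_s,V_T,M,k)$, consisting of a graph $G$, a subgraph $G_s$ of $G$, a set $V_T$ of test nodes of $G$, the inference function $M$ of a fixed, deterministic graph neural network, and an integer $k$, and asks whether $G_s$ is a $k$-robust counterfactual witness ($k$-RCW) for $V_T$ with respect to $M$.
   Context: $G=(V,E)$ is a connected graph with node set $V$, edge set $E\subseteq V\times V$, and a feature vector at every node. A GNN-based node classifier $\mathcal M$ has an inference function $M$, a polynomial-time computable function assigning to a test node $v$ and a graph $G$ a class label $M(v,G)=l$ from a finite label set. $\mathcal M$ is fixed (all factors determining $M$, such as layers and parameters, are fixed) and deterministic (same input gives same output). Conventions: $M(v,v)=l$ (a single node $v$ as graph receives its label $l=M(v,G)$); $M(v,\emptyset)$ and $M(\emptyset,G)$ are undefined (hence regarded as different from $l$). For a subgraph $G_w$ of $G$, $G\setminus G_w$ is the graph obtained from $G$ by removing all edges of $G_w$ while keeping all nodes. A $k$-disturbance to a graph flips at most $k$ node pairs (inserting the edge if absent, removing it if present). A $k$-disturbance on $G\setminus G_w$ flips only node pairs not in $G_w$, i.e. it neither inserts nor removes edges of $G_w$. Let $v$ be a test node with $M(v,G)=l$. A subgraph $G_w$ of $G$ is: (1) a factual witness of $M(v,G)=l$ if $M(v,G_w)=l$ (in particular $v$ is a node of $G_w$); (2) a counterfactual witness (CW) of $M(v,G)=l$ if it is a factual witness and $M(v,G\setminus G_w)\neq l$; (3) a $k$-robust counterfactual witness ($k$-RCW) of $M(v,G)=l$ if for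 any graph $\widetilde G$ obtained from $G$ by a $k$-disturbance on $G\setminus G_w$, $G_w$ remains a CW for $M(v,\widetilde G)=l$ (in particular $M(v,\widetilde G)=l$). $G_w$ is a $k$-RCW for a set $V_T$ of test nodes if it is a $k$-RCW of $M(v,G)=l$ for every $v\in V_T$ (with $l=M(v,G)$ depending on $v$). *)

(* Defs.v *)
From Stdlib Require Import PArith NArith.
From mathcomp Require Import all_boot all_order all_algebra.

Set Implicit Arguments.
Unset Strict Implicit.
Unset Printing Implicit Defensive.

(** * Polynomial time *)

(** Structured programs over finitely many stacks of bits.  Two stacks make a
    Turing-machine tape, and one elementary instruction costs one step and adds
    at most one bit to the store, so polynomial time here is polynomial time on
    multitape (oracle) Turing machines. *)

Definition language := seq bool -> Prop.

Definition store := nat -> seq bool.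

Inductive prog :=
| Skip
| Push (i : nat) (b : bool)
| Pop (i : nat)
| Seq (p q : prog)
| Case (i : nat) (pT pF pE : prog) (* top of [i] is 1 / is 0 / [i] is empty *)
| While (i : nat) (p : prog)       (* as long as [i] is nonempty *)
| Query (i : nat).                 (* replace [i] by the oracle's answer on it *)

Definition upd (s : store) (i : nat) (x : seq bool) : store :=
  fun j => if j == i then x else s j.

Definition branch (x : seq bool) (pT pF pE : prog) : prog :=
  match x with
  | true :: _ => pT
  | false :: _ => pF
  | [::] => pE
  end.

(** [exec O p s t s']: with oracle [O], [p] started in [s] halts in [s'] after
    [t] steps. *)
Inductive exec (O : language) : prog -> store -> nat -> store -> Prop :=
| ExecSkip s : exec O Skip s 1 s
| ExecPush s i b : exec O (Push i b) s 1 (upd s i (b :: s i))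
| ExecPop s i : exec O (Pop i) s 1 (upd s i (behead (s i)))
| ExecSeq p q s t s' t' s'' :
    exec O p s t s' -> exec O q s' t' s'' -> exec O (Seq p q) s (t + t') s''
| ExecCase i pT pF pE s t s' :
    exec O (branch (s i) pT pF pE) s t s' -> exec O (Case i pT pF pE) s t.+1 s'
| ExecWhileEnd i p s : s i = [::] -> exec O (While i p) s 1 s
| ExecWhileLoop i p s t s' t' s'' :
    s i <> [::] -> exec O p s t s' -> exec O (While i p) s' t' s'' ->
    exec O (While i p) s (t + t').+1 s''
| ExecQueryYes s i : O (s i) -> exec O (Query i) s 1 (upd s i [:: true])
| ExecQueryNo s i : ~ O (s i) -> exec O (Query i) s 1 (upd s i [:: false]).

(** Inputs are on stacks 0, 1, 2, ..., all other stacks being empty; the output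
    is on stack 0. *)
Definition load (xs : seq (seq bool)) : store := fun i => nth [::] xs i.

Definition runs (O : language) (p : prog) (c : nat)
    (xs : seq (seq bool)) (out : seq bool) : Prop :=
  exists (t : nat) (s : store),
    [/\ exec O p (load xs) t s, t <= sumn (map size xs) ^ c + c & s 0 = out].

Definition no_oracle : language := fun _ => False.

Definition NP (A : language) : Prop :=
  exists (V : seq bool -> seq bool -> bool) (p : prog) (c d : nat),
    (forall x w, runs no_oracle p c [:: x; w] [:: V x w]) /\
    (forall x, A x <-> exists w, size w <= size x ^ d + d /\ V x w).

(** Polynomial-time Turing (Cook) reducibility. *)
Definition turing_reducible (A B : language) : Prop :=
  exists (p : prog) (c : nat), forall x : seq bool,
    exists b : bool, (b <-> A x) /\ runs B p c [:: x] [:: b].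

(** Hardness is with respect to Turing reductions: the robustness condition
    below quantifies universally over disturbances, so for a polynomial-time
    classifier the problem is in coNP, and hardness under many-one reductions
    would amount to NP = coNP. *)
Definition np_hard (B : language) : Prop :=
  forall A : language, NP A -> turing_reducible A B.

(** * Binary encodings *)

(** Self-delimiting: every bit is preceded by 1 and every item ends with 0. *)
Definition enc_list (xs : seq (seq bool)) : seq bool :=
  flatten [seq rcons (flatten [seq [:: true; b] | b <- x]) false | x <- xs].

Fixpoint enc_pos (p : positive) : seq bool :=
  match p with
  | xH => [:: true]
  | xO q => false :: enc_pos q
  | xI q => true :: enc_pos q
  end.

Definition enc_nat (n : nat) : seq bool :=
  match N.of_nat n with
  | N0 => [::]
  | Npos p => enc_pos p
  end.

Definition enc_rat (r : rat) : seq bool :=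
  enc_list [:: (numq r < 0)%R :: enc_nat (absz (numq r));
               enc_nat (absz (denq r))].

Definition enc_set n (A : {set 'I_n}) : seq bool :=
  [seq i \in A | i <- enum 'I_n].

Definition enc_rel n (e : rel 'I_n) : seq bool :=
  enc_list [seq [seq e i j | j <- enum 'I_n] | i <- enum 'I_n].

Definition enc_feat n d (X : 'I_n -> 'rV[rat]_d) : seq bool :=
  enc_list [seq enc_list [seq enc_rat (X i ord0 j) | j <- enum 'I_d]
           | i <- enum 'I_n].

(** * Graphs *)

(** A graph whose nodes are among the elements of [T], so that a graph, its
    subgraphs and its disturbances all live over the same [T]. *)
Record graph (T : finType) := Graph { nodes : {set T}; adj : rel T }.

Definition simple_graph (T : finType) (G : graph T) : Prop :=
  [/\ symmetric (adj G), irreflexive (adj G) &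
      forall x y, adj G x y -> (x \in nodes G) && (y \in nodes G)].

Definition connected (T : finType) (G : graph T) : Prop :=
  nodes G != set0 /\ {in nodes G &, forall x y, connect (adj G) x y}.

Definition subgraph (T : finType) (H G : graph T) : Prop :=
  [/\ simple_graph H, nodes H \subset nodes G & subrel (adj H) (adj G)].

Definition remove_edges (T : finType) (G H : graph T) : graph T :=
  Graph (nodes G) (fun x y => adj G x y && ~~ adj H x y).

(** A node pair is the two-element set of its ends. *)
Definition flip (T : finType) (G : graph T) (F : {set {set T}}) : graph T :=
  Graph (nodes G) (fun x y => adj G x y (+) ([set x; y] \in F)).

(** [F] is the set of node pairs flipped by a [k]-disturbance on
    [remove_edges G H]. *)
Definition disturbance (T : finType) (k : nat) (G H : graph T)
    (F : {set {set T}}) : Prop :=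
  #|F| <= k /\
  forall e, e \in F -> exists x y,
    [/\ x \in nodes G, y \in nodes G, x != y, e = [set x; y] & ~~ adj H x y].

(** * Graph neural networks *)

(** Message-passing node classifiers: layer [i] updates the vector at a node
    from its current value and the multiset of its neighbours' values (a
    sequence, up to permutation); the label is read off the last layer. *)
Record gnn := Gnn {
  depth : nat;
  width : nat -> nat;
  nlabels : nat;
  layer : forall i,
    'rV[rat]_(width i) -> seq 'rV[rat]_(width i) -> 'rV[rat]_(width i.+1);
  readout : 'rV[rat]_(width depth) -> 'I_nlabels;
  layer_perm : forall i h (s1 s2 : seq 'rV[rat]_(width i)),
    perm_eq s1 s2 -> layer h s1 = layer h s2
}.

Fixpoint hidden (g : gnn) (T : finType) (e : rel T)
    (X : T -> 'rV[rat]_(width g 0)) (i : nat) : T -> 'rV[rat]_(width g i) :=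
  match i with
  | 0 => X
  | j.+1 => fun u =>
      layer (hidden e X j u) [seq hidden e X j w | w <- enum T & e u w]
  end.

(** Nodes outside a graph have no neighbours, so the node set need not be
    passed to the network. *)
Definition infer (g : gnn) (T : finType) (X : T -> 'rV[rat]_(width g 0))
    (v : T) (G : graph T) : 'I_(nlabels g) :=
  readout (hidden (adj G) X (depth g) v).

Definition poly_time_inference (g : gnn) : Prop :=
  exists (p : prog) (c : nat),
    forall n (G : graph 'I_n) (X : 'I_n -> 'rV[rat]_(width g 0)) (v : 'I_n),
      simple_graph G -> nodes G = [set: 'I_n] ->
      runs no_oracle p c [:: enc_rel (adj G); enc_feat X; enc_nat v]
        (enc_nat (infer X v G)).

(** * Witnesses *)

(** The label of [v] on [H] when [v] has the label [l] on the ambient graph: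
    undefined if [v] is not in [H], and [l], by convention, if [H] is [v]
    alone. *)
Definition label_on (g : gnn) (T : finType) (X : T -> 'rV[rat]_(width g 0))
    (l : 'I_(nlabels g)) (v : T) (H : graph T) : option 'I_(nlabels g) :=
  if v \notin nodes H then None
  else if nodes H == [set v] then Some l
  else Some (infer X v H).

Definition factual (g : gnn) (T : finType) (X : T -> 'rV[rat]_(width g 0))
    (l : 'I_(nlabels g)) (v : T) (H : graph T) : Prop :=
  label_on X l v H = Some l.

Definition counterfactual (g : gnn) (T : finType)
    (X : T -> 'rV[rat]_(width g 0)) (l : 'I_(nlabels g)) (v : T)
    (G H : graph T) : Prop :=
  factual X l v H /\ label_on X l v (remove_edges G H) <> Some l.

Definition robust_counterfactual (g : gnn) (T : finType)
    (X : T -> 'rV[rat]_(width g 0)) (k : nat) (v : T) (G H : graph T) : Prop :=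
  forall F, disturbance k G H F ->
    infer X v (flip G F) = infer X v G /\
    counterfactual X (infer X v G) v (flip G F) H.

(** * The verification problem *)

Record config (d : nat) := Config {
  nnodes : nat;
  input_graph : graph 'I_nnodes;
  features : 'I_nnodes -> 'rV[rat]_d;
  candidate : graph 'I_nnodes;
  test_nodes : {set 'I_nnodes};
  budget : nat
}.

Arguments features {d} C _ : rename.

Definition valid_config d (C : config d) : Prop :=
  [/\ simple_graph (input_graph C), nodes (input_graph C) = [set: 'I_(nnodes C)],
      connected (input_graph C) & subgraph (candidate C) (input_graph C)].

Definition enc_config d (C : config d) : seq bool :=
  enc_list [:: enc_rel (adj (input_graph C)); enc_feat (features C);
               enc_set (nodes (candidate C)); enc_rel (adj (candidate C));
               enc_set (test_nodes C); enc_nat (budget C)].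

Definition rcw_verification (g : gnn) : language := fun x =>
  exists C : config (width g 0),
    [/\ x = enc_config C, valid_config C &
        {in test_nodes C, forall v, robust_counterfactual (features C)
           (budget C) v (input_graph C) (candidate C)}].

(* Main.v *)
(** A depth-one network can read an arbitrary string off the numerator of the
    feature of a node, and the edges at a test node encode a bit string: give
    node [i] the feature [2 ^ i] and take the bitwise disjunction over the
    neighbours.  So one network can simulate a universal machine, with code,
    first input and number of steps given by the feature of the test node, and
    the second input given by its neighbours.

    For a language in NP with verifier [V] and an input [x], take a star with
    centre 0 and test node 1, and the edge between them as the candidate
    witness.  A test node adjacent to the centre gets the label 1 unless its
    other neighbours encode some [w] accepted by [V x]; a test node not adjacent
    to the centre gets the label 0.  Disturbances cannot touch the candidate but
    choose the other neighbours freely, so the candidate is a robust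
    counterfactual witness exactly when no [w] is accepted. *)

Require Import Defs.
From Stdlib Require Import FunctionalExtensionality PArith NArith Classical.
From HB Require Import structures.
From mathcomp Require Import all_boot all_order all_algebra zify.

Set Implicit Arguments.
Unset Strict Implicit.
Unset Printing Implicit Defensive.

(** The main obstacle is polynomial time, which here means stack programs: both the inference of the
    network and the map from strings to instances must be given as such. Apart from a few basic
    programs they are assembled from functions on binary trees, whose polynomial-time computability
    is closed under composition, pairing, tests and left folds of controlled growth. This is why
    string functions are phrased as left folds throughout.

    The network has to be fast on every graph, not only on stars with meaningful features. So the
    number of simulated steps is the length of a list inside the feature of the test node, that is,
    unary, and the size of the machine is bounded for arbitrary code.

    A disjunction is exactly as long as its highest bit, so neighbours alone cannot spell a string
    ending in zeros; the end marker removes this restriction. The numeral of [2 ^ i] has only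
    [i + 1] bits, so exponentially large features still give an instance of polynomial length. *)

Definition polyb A (m f : A -> nat) := exists c, forall x, f x <= (m x).+2 ^ c.

(** * Polynomial bounds *)

Section Poly.
Variables (A : Type) (m : A -> nat).

Lemma poly_le f g : polyb m g -> (forall x, f x <= g x) -> polyb m f.
Proof. by case=> c gc le_fg; exists c => x; apply: leq_trans (le_fg x) (gc x). Qed.

Lemma poly_measure : polyb m m.
Proof. by exists 1 => x; lia. Qed.

Lemma poly_const k : polyb m (fun=> k).
Proof.
exists k => x; apply: (@leq_trans (2 ^ k)); first exact/ltnW/ltn_expl.
by case: k => // k; rewrite leq_exp2r.
Qed.

Lemma poly_mul f g : polyb m f -> polyb m g -> polyb m (fun x => f x * g x).
Proof.
by move=> [c fc] [d gd]; exists (c + d) => x; rewrite expnD leq_mul.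
Qed.

Lemma poly_exp f c : polyb m f -> polyb m (fun x => f x ^ c).
Proof.
move=> [d fd]; exists (d * c) => x; rewrite expnM.
by case: c => // c; rewrite leq_exp2r.
Qed.

(** The base is at least 2, so one more factor of it absorbs the sum of two equal powers. *)
Lemma poly_add f g : polyb m f -> polyb m g -> polyb m (fun x => f x + g x).
Proof.
move=> [c fc] [d gd]; exists (c + d).+1 => x.
have h1 : f x <= (m x).+2 ^ (c + d).
  by apply: leq_trans (fc x) _; rewrite leq_exp2l // leq_addr.
have h2 : g x <= (m x).+2 ^ (c + d).
  by apply: leq_trans (gd x) _; rewrite leq_exp2l // leq_addl.
rewrite expnS; nia.
Qed.

Lemma poly_succ f : polyb m f -> polyb m (fun x => (f x).+1).
Proof.
move=> hf; apply: poly_le (poly_add (poly_const 1) hf) _ => x; exact: leqnn.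
Qed.

Lemma poly_comp B (m' f : B -> nat) (h : A -> B) :
  polyb m' f -> polyb m (fun x => m' (h x)) -> polyb m (fun x => f (h x)).
Proof.
(* Two extra factors of the base pay for the [.+2] that is added to the inner bound. *)
move=> [c fc] [d hd]; exists (d.+2 * c) => x.
apply: leq_trans (fc _) _; rewrite expnM; case: c {fc} => // c.
rewrite leq_exp2r // 2!expnS.
have := hd x; have : 0 < (m x).+2 ^ d by rewrite expn_gt0.
move: ((m x).+2 ^ d) => e; nia.
Qed.

End Poly.

(** Passes to the form of bound in [runs], whose base may be 0 or 1: the summand [3 ^ c] covers
    these two cases, and from 2 on the square of a number exceeds it by at least 2. *)
Lemma poly_runs (n : nat) c (c' := 2 * c + 3 ^ c) : n.+2 ^ c <= n ^ c' + c'.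
Proof.
case: n => [|[|n]].
- apply: leq_trans (leq_addl _ _); apply: leq_trans (leq_addl _ _).
  by case: c {c'} => // c; rewrite leq_exp2r.
- by rewrite exp1n /c'; lia.
- apply: leq_trans (leq_addr _ _); apply: (@leq_trans (n.+2 ^ (2 * c))).
    by rewrite expnM; case: c {c'} => // c; rewrite leq_exp2r //; nia.
  by rewrite leq_exp2l // leq_addr.
Qed.

Ltac poly_tac := repeat match goal with
  | |- polyb _ (fun x => @?f x + @?g x) => apply: (@poly_add _ _ f g)
  | |- polyb _ (fun x => @?f x * @?g x) => apply: (@poly_mul _ _ f g)
  | |- polyb _ (fun x => @?f x ^ _) => apply: (@poly_exp _ _ f)
  | |- polyb _ (fun x => (@?f x).+1) => apply: (@poly_succ _ _ f)
  | _ => first [ assumption | exact: poly_const | exact: poly_measure ]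
  end.

(** * Relocatable programs *)

(* The stacks from [r] on are those of [xs], then empty ones. *)
Definition frame (s : store) (r : nat) (xs : seq (seq bool)) : store :=
  fun j => if j < r then s j else nth [::] xs (j - r).

Notation stk := (nth ([::] : seq bool)).
Notation setstk := (set_nth ([::] : seq bool)).

Ltac nths := rewrite ?nth_set_nth /=;
  repeat (case: eqP => [?|?] //; try congruence; rewrite ?nth_set_nth /= ).

Lemma eq_frame s r xs ys : (forall k, stk xs k = stk ys k) -> frame s r xs = frame s r ys.
Proof.
by move=> e; apply: functional_extensionality => j; rewrite /frame e.
Qed.

Lemma frame_get s r xs k : frame s r xs (k + r) = stk xs k.
Proof. by rewrite /frame addnK; case: ifP => //; lia. Qed.

Lemma frame_set s r xs k v : upd (frame s r xs) (k + r) v = frame s r (setstk xs k v).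
Proof.
apply: functional_extensionality => j; rewrite /upd /frame nth_set_nth /=.
case: ltnP => [lt_jr|le_rj]; first by case: eqP => //; lia.
by have -> : (j == k + r) = (j - r == k) by lia.
Qed.

Lemma frame_cons s r a xs : frame s r (a :: xs) = frame (frame s r [:: a]) r.+1 xs.
Proof.
apply: functional_extensionality => j; rewrite /frame ltnS.
case: (ltngtP j r) => // [lt_rj|->]; last by rewrite subnn.
by rewrite -(subnSK lt_rj).
Qed.

Lemma frame0 s xs : frame s 0 xs = load xs.
Proof. by apply: functional_extensionality => j; rewrite /frame /load subn0. Qed.

Definition run (P : nat -> prog) xs n ys := forall O s r,
  exists2 m, m <= n & exec O (P r) (frame s r xs) m (frame s r ys).

Lemma run_le P xs n n' ys : run P xs n ys -> n <= n' -> run P xs n' ys.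
Proof.
by move=> h le_n O s r; have [m le_m e] := h O s r; exists m => //; apply: leq_trans le_m le_n.
Qed.

(** A list of stacks matters only up to trailing empty stacks, so lists are compared entry by entry
    with default [[::]]. *)
Lemma run_ext P xs xs' n ys ys' :
    (forall k, stk xs k = stk xs' k) -> (forall k, stk ys k = stk ys' k) ->
  run P xs n ys -> run P xs' n ys'.
Proof. by move=> /eq_frame ex /eq_frame ey h O s r; rewrite -ex -ey. Qed.

Definition skip : nat -> prog := fun=> Skip.
Definition push k b : nat -> prog := fun r => Push (k + r) b.
Definition pop k : nat -> prog := fun r => Pop (k + r).
Definition sq (P Q : nat -> prog) : nat -> prog := fun r => Seq (P r) (Q r).
Definition case k (P Q R : nat -> prog) : nat -> prog :=
  fun r => Case (k + r) (P r) (Q r) (R r).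
Definition while k (P : nat -> prog) : nat -> prog := fun r => While (k + r) (P r).
Definition above (P : nat -> prog) : nat -> prog := fun r => P r.+1.

Notation "P ;; Q" := (sq P Q) (at level 60, right associativity).

Lemma run_skip xs : run skip xs 1 xs.
Proof. by move=> O s r; exists 1 => //; constructor. Qed.

Lemma run_push k b xs : run (push k b) xs 1 (setstk xs k (b :: stk xs k)).
Proof.
by move=> O s r; exists 1 => //; rewrite -frame_set -(frame_get s r); constructor.
Qed.

Lemma run_pop k xs : run (pop k) xs 1 (setstk xs k (behead (stk xs k))).
Proof.
by move=> O s r; exists 1 => //; rewrite -frame_set -(frame_get s r); constructor.
Qed.

Lemma run_seq P Q xs n ys n' zs :
  run P xs n ys -> run Q ys n' zs -> run (P ;; Q) xs (n + n') zs.
Proof.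
move=> hP hQ O s r; have [m le_m eP] := hP O s r; have [m' le_m' eQ] := hQ O s r.
by exists (m + m'); [exact: leq_add | exact: ExecSeq eP eQ].
Qed.

Lemma run_case k P Q R xs n ys :
    run (match stk xs k with true :: _ => P | false :: _ => Q | [::] => R end) xs n ys ->
  run (case k P Q R) xs n.+1 ys.
Proof.
move=> h O s r; have [m le_m e] := h O s r; exists m.+1 => //; constructor.
by rewrite frame_get; case: (stk xs k) e => [|[] ?].
Qed.

Lemma run_while0 k P xs : stk xs k = [::] -> run (while k P) xs 1 xs.
Proof. by move=> h O s r; exists 1 => //; constructor; rewrite frame_get. Qed.

Lemma run_whileS k P xs n ys n' zs : stk xs k != [::] ->
  run P xs n ys -> run (while k P) ys n' zs -> run (while k P) xs (n + n').+1 zs.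
Proof.
move=> /eqP k0 hP hW O s r; have [m le_m eP] := hP O s r; have [m' le_m' eW] := hW O s r.
exists (m + m').+1; first by rewrite ltnS leq_add.
by apply: ExecWhileLoop eP eW; rewrite frame_get.
Qed.

(** The first stack is absorbed into the part of the store that a run leaves untouched. *)
Lemma run_above P a xs n ys : run P xs n ys -> run (above P) (a :: xs) n (a :: ys).
Proof. by move=> h O s r; rewrite (frame_cons s r a xs) (frame_cons s r a ys); exact: h. Qed.

(** A move reverses the string, so an order-preserving transfer takes two moves through a spare
    stack. *)
Definition mv k l := while k
  (case k (pop k ;; push l true) (pop k ;; push l false) skip).

Lemma run_mv k l xs : k != l ->
  run (mv k l) xs (4 * size (stk xs k) + 1)
    (setstk (setstk xs l (catrev (stk xs k) (stk xs l))) k [::]).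
Proof.
move=> kl; move ex : (stk xs k) => x; elim: x xs ex => [|b x IH] xs ex.
  apply: run_ext (run_while0 _ ex) => // j; rewrite !nth_set_nth /= .
  by case: eqP => [->//|_]; rewrite nth_set_nth /=; case: eqP => [->|].
set ys := setstk (setstk xs k x) l (b :: stk xs l).
have run1 : run (case k (pop k ;; push l true) (pop k ;; push l false) skip) xs 3 ys.
  apply: run_case; rewrite ex.
  have := run_pop k xs; rewrite ex /= => h.
  have := run_push l b (setstk xs k x); rewrite nth_set_nth /= [l == k]eq_sym (negPf kl) => h'.
  by rewrite /ys; case: (b) h' => h'; exact: run_seq h h'.
have eyk : stk ys k = x by rewrite !nth_set_nth /= (negPf kl) nth_set_nth /= eqxx.
have eyl : stk ys l = b :: stk xs l by rewrite nth_set_nth /= eqxx.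
apply: (run_le (n := (3 + (4 * size x + 1)).+1)); last by rewrite /=; lia.
apply: run_whileS run1 _; first by rewrite ex.
apply: run_ext (IH _ eyk) => // j; rewrite eyl !nth_set_nth /=.
by case: eqP => // jk; nths.
Qed.

Definition mv2 k l l' := while k
  (case k (pop k ;; push l true ;; push l' true) (pop k ;; push l false ;; push l' false) skip).

Lemma run_mv2 k l l' xs : k != l -> k != l' -> l != l' ->
  run (mv2 k l l') xs (5 * size (stk xs k) + 1)
    (setstk (setstk (setstk xs l' (catrev (stk xs k) (stk xs l'))) l
       (catrev (stk xs k) (stk xs l))) k [::]).
Proof.
move=> kl kl' ll'; move ex : (stk xs k) => x; elim: x xs ex => [|b x IH] xs ex.
  apply: run_ext (run_while0 _ ex) => // j; rewrite !nth_set_nth /= .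
  case: eqP => [->//|_]; rewrite nth_set_nth /=; case: eqP => [->//|_].
  by rewrite nth_set_nth /=; case: eqP => [->|].
set ys := setstk (setstk (setstk xs k x) l (b :: stk xs l)) l' (b :: stk xs l').
have run1 : run (case k (pop k ;; push l true ;; push l' true)
    (pop k ;; push l false ;; push l' false) skip) xs 4 ys.
  apply: run_case; rewrite ex.
  have := run_pop k xs; rewrite ex /= => h.
  have := run_push l b (setstk xs k x); rewrite nth_set_nth /= [l == k]eq_sym (negPf kl) => h'.
  have := run_push l' b (setstk (setstk xs k x) l (b :: stk xs l)).
  rewrite nth_set_nth /= [l' == l]eq_sym (negPf ll') nth_set_nth /= [l' == k]eq_sym (negPf kl') => h''.
  by rewrite /ys; case: (b) h' h'' => h' h''; exact: run_seq h (run_seq h' h'').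
have eyk : stk ys k = x.
  by rewrite !nth_set_nth /= (negPf kl') nth_set_nth /= (negPf kl) nth_set_nth /= eqxx.
have eyl : stk ys l = b :: stk xs l.
  by rewrite nth_set_nth /= (negPf ll') nth_set_nth /= eqxx.
have eyl' : stk ys l' = b :: stk xs l' by rewrite nth_set_nth /= eqxx.
apply: (run_le (n := (4 + (5 * size x + 1)).+1)); last by rewrite /=; lia.
apply: run_whileS run1 _; first by rewrite ex.
apply: run_ext (IH _ eyk) => // j; rewrite eyl eyl' !nth_set_nth /=.
by case: eqP => // jk; nths.
Qed.

Definition clear k := while k (pop k).

Lemma run_clear k xs : run (clear k) xs (2 * size (stk xs k) + 1) (setstk xs k [::]).
Proof.
move ex : (stk xs k) => x; elim: x xs ex => [|b x IH] xs ex.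
  apply: run_ext (run_while0 _ ex) => // j; rewrite nth_set_nth /=.
  by case: eqP => [->|].
apply: (run_le (n := (1 + (2 * size x + 1)).+1)); last by rewrite /=; lia.
apply: run_whileS (run_pop k xs) _; first by rewrite ex.
have eyk : stk (setstk xs k (behead (stk xs k))) k = x by rewrite nth_set_nth /= eqxx ex.
apply: run_ext (IH _ eyk) => // j; rewrite !nth_set_nth /=.
by case: eqP => // ?; rewrite nth_set_nth /=; case: eqP.
Qed.

(** * Functions computable in polynomial time *)

(** All data are coded as binary trees. Their prefix code is self-delimiting, so a pair is one bit
    followed by the two codes, and no separators or lengths are stored. *)
Inductive tree := Leaf | Node (a b : tree).

Fixpoint pre t : seq bool :=
  if t is Node a b then true :: pre a ++ pre b else [:: false].

Class encodable (T : Type) := en : T -> tree.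

Definition sz {T : Type} {eT : encodable T} (x : T) := size (pre (en x)).

Instance tree_enc : encodable tree := id.
Instance bool_enc : encodable bool := fun b => if b then Node Leaf Leaf else Leaf.
Instance prod_enc T U (eT : encodable T) (eU : encodable U) : encodable (T * U) :=
  fun p => Node (en p.1) (en p.2).
Instance seq_enc T (eT : encodable T) : encodable (seq T) :=
  fix enl (s : seq T) := if s is x :: s' then Node (en x) (enl s') else Leaf.

Lemma run_eq P xs n ys zs :
  run P xs n ys -> (forall k, stk ys k = stk zs k) -> run P xs n zs.
Proof. by move=> h e; apply: run_ext h. Qed.

Ltac stks := do 8?case=> //=; rewrite ?catrevE ?cats0 ?rev_cat ?revK ?nth_nil //=; rewrite ?rev_cat ?revK //=.

(* [k] loses its first tree, which goes reversed on [u]; [t] counts the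
   subtrees that are still to be read. *)
Definition pop_tree_body k u t :=
  case k (pop k ;; push u true ;; push t true) (pop k ;; push u false ;; pop t) (pop t).
Definition pop_tree k u t := push t true ;; while t (pop_tree_body k u t).

(** Stated with the remaining run [zs] as a continuation, so that the induction hypothesis applies
    to the two subtrees in turn. At a node one tree to be read becomes two, at a leaf one is done;
    each bit costs five steps. *)
Lemma run_pop_tree_loop k u t y : k != u -> k != t -> u != t ->
  forall xs rest c n zs, stk xs k = pre y ++ rest -> stk xs t = true :: c ->
  run (while t (pop_tree_body k u t))
    (setstk (setstk (setstk xs k rest) u (catrev (pre y) (stk xs u))) t c) n zs ->
  run (while t (pop_tree_body k u t)) xs (5 * size (pre y) + n) zs.
Proof.
move=> ku kt ut; have uk : (u == k) = false by rewrite eq_sym (negPf ku).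
have tk : (t == k) = false by rewrite eq_sym (negPf kt).
have tu : (t == u) = false by rewrite eq_sym (negPf ut).
elim: y => [|a IHa b IHb] xs rest c n zs /= ek et h.
  have -> : 5 * 1 + n = (4 + n).+1 by lia.
  apply: run_whileS h; first by rewrite et.
  apply: run_case; rewrite ek; apply: run_seq (run_pop _ _) _.
  apply: run_seq (run_push _ _ _) _; apply: run_eq (run_pop _ _) _ => j.
  by do ![rewrite !nth_set_nth /= ?uk ?tk ?tu ?ek ?et /=]; nths.
set ys := setstk (setstk (setstk xs k (pre a ++ pre b ++ rest)) u (true :: stk xs u))
  t (true :: true :: c).
have yt : stk ys t = true :: true :: c by rewrite !nth_set_nth /= eqxx.
have yu : stk ys u = true :: stk xs u.
  by rewrite nth_set_nth /= (negPf ut) nth_set_nth /= eqxx.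
have yk : stk ys k = pre a ++ pre b ++ rest.
  by rewrite nth_set_nth /= (negPf kt) nth_set_nth /= (negPf ku) nth_set_nth /= eqxx.
apply: (run_le (n := (4 + (5 * size (pre a) + (5 * size (pre b) + n))).+1)).
  apply: (@run_whileS _ _ _ _ ys); first by rewrite et.
    apply: run_case; rewrite ek; apply: run_seq (run_pop _ _) _.
    apply: run_seq (run_push _ _ _) _; apply: run_eq (run_push _ _ _) _ => j.
    by rewrite /ys; do ![rewrite !nth_set_nth /= ?uk ?tk ?tu ?ek ?et /=]; nths; rewrite catA.
  apply: IHa yk yt _; apply: IHb.
  - by rewrite nth_set_nth /= (negPf kt) nth_set_nth /= (negPf ku) nth_set_nth /= eqxx.
  - by rewrite nth_set_nth /= eqxx.
  apply: run_ext h => // j; rewrite !catrevE rev_cat yu.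
  set v := stk (setstk _ _ _) u; have -> : v = rev (pre a) ++ true :: stk xs u.
    by rewrite /v nth_set_nth /= (negPf ut) nth_set_nth /= eqxx.
  rewrite /ys -catA; nths.
by rewrite size_cat; lia.
Qed.

Lemma run_pop_tree k u t y xs rest : k != u -> k != t -> u != t ->
  stk xs k = pre y ++ rest -> stk xs t = [::] ->
  run (pop_tree k u t) xs (5 * size (pre y) + 2)
    (setstk (setstk xs k rest) u (catrev (pre y) (stk xs u))).
Proof.
move=> ku kt ut ek et.
have uk : (u == k) = false by rewrite eq_sym (negPf ku).
apply: (run_le (n := 1 + (5 * size (pre y) + 1))); last by lia.
apply: run_seq (run_push _ _ _) _.
apply: (@run_pop_tree_loop k u t y ku kt ut _ rest [::]).
- by rewrite nth_set_nth /= (negPf kt).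
- by rewrite nth_set_nth /= eqxx et.
apply: run_eq; first by apply: run_while0; rewrite nth_set_nth /= eqxx.
move=> j; rewrite !nth_set_nth /= (negPf ut).
by nths; subst; rewrite ?et //; move: ku kt ut; rewrite ?eqxx.
Qed.

Ltac sizes := rewrite /= !(catrevE, cats0, size_cat, size_rev) /=; lia.
Tactic Notation "go" uconstr(L) := eapply run_seq; [eapply L; try done | rewrite /= ].
Tactic Notation "stop" uconstr(L) := eapply run_eq; [eapply L; try done | stks ].

Definition dup := mv 0 2 ;; mv2 2 0 1.

Lemma run_dup x : run dup [:: x] (9 * size x + 2) [:: x; x].
Proof.
apply: run_le; first by go run_mv; stop run_mv2.
by sizes.
Qed.

Definition swap := mv 0 2 ;; mv 2 3 ;; mv 1 2 ;; mv 2 0 ;; mv 3 2 ;; mv 2 1.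

Lemma run_swap x y : run swap [:: x; y] (16 * size x + 8 * size y + 6) [:: y; x].
Proof.
apply: run_le.
  by do 5![go run_mv]; stop run_mv.
by sizes.
Qed.

Definition unpair := pop 0 ;; pop_tree 0 1 2 ;; mv 0 2 ;; mv 1 0 ;; mv 2 1.

Lemma run_unpair a b : run unpair [:: pre (Node a b)]
  (9 * size (pre a) + 8 * size (pre b) + 6) [:: pre a; pre b].
Proof.
apply: run_le.
  go run_pop; go (@run_pop_tree 0 1 2 a _ (pre b)); do 2![go run_mv]; stop run_mv.
by sizes.
Qed.

Definition mkpair := mv 0 2 ;; mv 2 1 ;; push 1 true ;; mv 1 2 ;; mv 2 0.

Lemma run_mkpair a b : run mkpair [:: pre a; pre b]
  (16 * size (pre a) + 8 * size (pre b) + 13) [:: pre (Node a b)].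
Proof.
apply: run_le.
  go run_mv; go run_mv; go run_push; go run_mv; stop run_mv.
by sizes.
Qed.

(** The bound on the size of the output is what makes the time bounds compose. *)
Definition fp T U {eT : encodable T} {eU : encodable U} (f : T -> U) :=
  exists P t, [/\ polyb sz t, polyb sz (fun x => sz (f x)) &
    forall x, run P [:: pre (en x)] (t x) [:: pre (en (f x))]].

Lemma sz_pair T U {eT : encodable T} {eU : encodable U} (x : T) (y : U) :
  sz (x, y) = (sz x + sz y).+1.
Proof. by rewrite /sz /= size_cat. Qed.

Lemma sz_cons T {eT : encodable T} (x : T) s : sz (x :: s) = (sz x + sz s).+1.
Proof. by rewrite /sz /= size_cat. Qed.

Lemma sz_nil T {eT : encodable T} : sz ([::] : seq T) = 1.
Proof. by []. Qed.

Lemma sz_gt0 T {eT : encodable T} (x : T) : 0 < sz x.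
Proof. by rewrite /sz; case: (en x). Qed.

Lemma sz_bool (b : bool) : sz b <= 3.
Proof. by case: b. Qed.

Lemma size_sz T {eT : encodable T} (s : seq T) : size s < sz s.
Proof. by elim: s => //= x s IH; rewrite sz_cons; lia. Qed.

Lemma sz_bits (s : seq bool) : sz s <= 4 * size s + 1.
Proof. by elim: s => //= x s IH; rewrite sz_cons; have := sz_bool x; lia. Qed.

Section Closure.
Context {T U V : Type} {eT : encodable T} {eU : encodable U} {eV : encodable V}.

Lemma fp_eq (f g : T -> U) : f =1 g -> fp f -> fp g.
Proof. by move/functional_extensionality->. Qed.

(** Programs see only the codes, so one program serves functions that agree on codes. This is how a
    list is treated as a pair or as a tree, and conversely. *)
Lemma fp_conv T' U' {eT' : encodable T'} {eU' : encodable U'} (h : T' -> T)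
    (f : T -> U) (g : T' -> U') : (forall x, en (h x) = en x) ->
  (forall x, en (g x) = en (f (h x))) -> fp f -> fp g.
Proof.
move=> eh eg [P [t [pt pf hP]]]; have szh x : sz (h x) = sz x by rewrite /sz eh.
exists P, (fun x => t (h x)); split=> [||x].
- by case: pt => c ct; exists c => x; rewrite -(szh x).
- by case: pf => c cf; exists c => x; rewrite -(szh x) {1}/sz eg; exact: cf.
- by rewrite eg -eh.
Qed.

Lemma fp_id : fp (@id T).
Proof.
exists skip, (fun=> 1); split; [exact: poly_const | exact: poly_measure |].
by move=> x; exact: run_skip.
Qed.

Lemma fp_comp (f : T -> U) (g : U -> V) : fp f -> fp g -> fp (fun x => g (f x)).
Proof.
move=> [P [t [pt pf hP]]] [Q [t' [pt' pg hQ]]].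
exists (P ;; Q), (fun x => t x + t' (f x)); split.
- by poly_tac; exact: (poly_comp pt' pf).
- exact: (poly_comp pg pf).
- by move=> x; apply: run_seq (hP x) (hQ _).
Qed.

Lemma fp_const (c : U) : fp (fun _ : T => c).
Proof.
pose puts := foldr (fun b P => P ;; push 0 b) skip.
have run_puts s xs : run (puts s) (xs :: [::]) (size s).+1 [:: s ++ xs].
  elim: s xs => [|b s IH] xs /=; first exact: run_skip.
  by rewrite -addn1; apply: run_seq (IH xs) _; exact: run_push.
exists (clear 0 ;; puts (pre (en c))), (fun x => 2 * sz x + 1 + (sz c).+1).
split; try by poly_tac.
move=> x; go run_clear; rewrite -[in X in run _ _ _ X](cats0 (pre _)).
exact: run_puts.
Qed.

Lemma fp_pair (f : T -> U) (g : T -> V) : fp f -> fp g -> fp (fun x => (f x, g x)).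
Proof.
move=> [P [t [pt pf hP]]] [Q [t' [pt' pg hQ]]].
exists (dup ;; above P ;; swap ;; above Q ;; mkpair).
eexists; split; last first.
- move=> x; go run_dup; go (run_above _ (hP x)); go run_swap; go (run_above _ (hQ x)).
  exact: (run_mkpair (en (f x)) (en (g x))).
- apply: (@poly_le _ _ _ (fun x => (sz (f x) + sz (g x)).+1)); last by move=> x; rewrite sz_pair.
  by poly_tac.
- by rewrite -/(sz _); poly_tac.
Qed.

(** The first bit of a code tells a node from a leaf; tests on booleans, lists and trees all reduce
    to this one. *)
Lemma fp_if_leaf (c : T -> U) (f g : T -> V) : fp c -> fp f -> fp g ->
  fp (fun x => if en (c x) is Leaf then f x else g x).
Proof.
move=> [C [tc [ptc pc hC]]] [P [t [pt pf hP]]] [Q [t' [pt' pg hQ]]].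
exists (dup ;; above C ;; case 1 (clear 1 ;; Q) (clear 1 ;; P) skip).
exists (fun x => 9 * sz x + 2 + (tc x + (2 * sz (c x) + 1 + (t x + t' x)).+1)); split.
- by poly_tac.
- apply: (@poly_le _ _ _ (fun x => sz (f x) + sz (g x))); first by poly_tac.
  by move=> x; case: (en _); lia.
move=> x; go run_dup; go (run_above _ (hC x)); apply: run_case; rewrite /= /sz.
case ec: (en (c x)) => [|a b].
  apply: run_le; first by go run_clear; apply: run_ext (hP x) => // -[|[|[|]]].
  by rewrite /= /sz; lia.
apply: run_le; first by go run_clear; apply: run_ext (hQ x) => // -[|[|[|]]].
by rewrite /= /sz; lia.
Qed.

End Closure.

Lemma fp_if T V {eT : encodable T} {eV : encodable V} (b : T -> bool) (f g : T -> V) :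
  fp b -> fp f -> fp g -> fp (fun x => if b x then f x else g x).
Proof.
move=> hb hf hg; apply: fp_eq (fp_if_leaf hb hg hf) => x.
by case: (b x).
Qed.

Lemma fp_fst0 T U {eT : encodable T} {eU : encodable U} : fp (@fst T U).
Proof.
exists (unpair ;; clear 1).
exists (fun p => 9 * sz p.1 + 8 * sz p.2 + 6 + (2 * sz p.2 + 1)).
have h1 : polyb (@sz (T * U) _) (fun p => sz p.1).
  by apply: poly_le (poly_measure _) _ => -[x y]; rewrite sz_pair /=; lia.
have h2 : polyb (@sz (T * U) _) (fun p => sz p.2).
  by apply: poly_le (poly_measure _) _ => -[x y]; rewrite sz_pair /=; lia.
split=> [||[x y]]; poly_tac.
by go run_unpair; stop run_clear.
Qed.

Lemma fp_snd0 T U {eT : encodable T} {eU : encodable U} : fp (@snd T U).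
Proof.
exists (unpair ;; clear 0 ;; mv 1 2 ;; mv 2 0).
exists (fun p => 9 * sz p.1 + 8 * sz p.2 + 6 + (2 * sz p.1 + 1 + (8 * sz p.2 + 2))).
have h1 : polyb (@sz (T * U) _) (fun p => sz p.1).
  by apply: poly_le (poly_measure _) _ => -[x y]; rewrite sz_pair /=; lia.
have h2 : polyb (@sz (T * U) _) (fun p => sz p.2).
  by apply: poly_le (poly_measure _) _ => -[x y]; rewrite sz_pair /=; lia.
split=> [||[x y]]; poly_tac.
apply: run_le.
  go run_unpair; go run_clear; go run_mv; stop run_mv.
by rewrite /sz; sizes.
Qed.

(** * Left folds in polynomial time *)

Section Foldl.
Context {X A Y : Type} {eX : encodable X} {eA : encodable A} {eY : encodable Y}.

(** Stacks 0, 1 and 2 hold the parameter, the rest of the list and the accumulator. The triple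
    [(x, a, y)] is built on stack 3 from its last component upwards; the two pushed bits are the
    headers of its two pairs. *)
Definition fold_body (G : nat -> prog) :=
  pop 1 ;; pop_tree 1 5 4 ;; mv 5 3 ;; mv 2 4 ;; mv 4 3 ;; mv 0 4 ;; mv2 4 0 3 ;;
  push 3 true ;; push 3 true ;; above (above (above G)) ;; mv 3 4 ;; mv 4 2.

Lemma run_fold_body (g : X -> A -> Y -> A) G n x a y l :
    run G [:: pre (en (x, a, y))] n [:: pre (en (g x a y))] ->
  run (fold_body G) [:: pre (en x); pre (en (y :: l)); pre (en a)]
    (n + 9 * (sz x + sz a + sz y + sz (g x a y)) + 12)
    [:: pre (en x); pre (en l); pre (en (g x a y))].
Proof.
move=> hG; apply: run_le.
  go run_pop; go (@run_pop_tree 1 5 4 (en y) _ (pre (en l))).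
  do 4![go run_mv]; go run_mv2; do 2![go run_push].
  eapply run_seq.
    do 3![apply: run_above]; apply: run_ext hG; last by [].
    by stks; rewrite ?catA.
  by go run_mv; stop run_mv.
by rewrite /sz; sizes.
Qed.

(* Popping the [false] that ends the list empties stack 1 and stops the loop. *)
Definition fold_loop G := while 1 (case 1 (fold_body G) (pop 1) skip).

(** [M] bounds the accumulator after every prefix of the list, and the time of a step from there, so
    that all rounds have the same cost. *)
Lemma run_fold_loop (g : X -> A -> Y -> A) G t x M l :
    (forall a y, run G [:: pre (en (x, a, y))] (t a y) [:: pre (en (g x a y))]) ->
  forall a, (forall k, let b := foldl (g x) a (take k l) in
    sz b <= M /\ forall y, sz y <= sz l -> t b y <= M) ->
  run (fold_loop G) [:: pre (en x); pre (en l); pre (en a)]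
    (size l * (M + 9 * (sz x + M + sz l + M) + 14) + 4)
    [:: pre (en x); [::]; pre (en (foldl (g x) a l))].
Proof.
move=> hG; elim: l => [|y l IH] a hM.
  apply: (run_le (n := (2 + 1).+1)); last by lia.
  apply: run_whileS => //; last by apply: run_while0.
  by apply: run_case; apply: run_eq; [exact: run_pop | stks].
have szl : sz l <= sz (y :: l) by rewrite sz_cons; lia.
have [szM tM] := hM 0; have {tM} tM := tM y; rewrite /= in szM tM.
have [/= szM' _] := hM 1; rewrite take0 /= in szM'.
apply: (run_le (n := ((M + 9 * (sz x + M + sz y + M) + 12).+1 +
   (size l * (M + 9 * (sz x + M + sz l + M) + 14) + 4)).+1)); last first.
  by rewrite sz_cons /=; nia.
apply: run_whileS => //.
  apply: run_case => /=; apply: run_le; first exact: run_fold_body (hG a y).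
  by rewrite sz_cons in tM; lia.
apply: IH => k; have [? h] := hM k.+1; split=> // z hz; apply: h.
by apply: leq_trans hz szl.
Qed.

(** Iterating a polynomial-time step can blow up exponentially. The last hypothesis excludes this:
    accumulators stay polynomial in the parameter alone, uniformly in the length of the prefix. *)
Lemma fp_foldl_take (l : X -> seq Y) (a : X -> A) (g : X -> A -> Y -> A) :
    fp l -> fp a -> fp (fun p : X * A * Y => g p.1.1 p.1.2 p.2) ->
    polyb (fun p : X * nat => sz p.1)
      (fun p => sz (foldl (g p.1) (a p.1) (take p.2 (l p.1)))) ->
  fp (fun x => foldl (g x) (a x) (l x)).
Proof.
move=> fl fa [G [t [pt pg hG]]] [c hc].
have [P [tp [ptp pp hP]]] := fp_pair fp_id (fp_pair fl fa).
have [cl hl] : polyb sz (fun x => sz (l x)) by case: fl => ? [? []].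
have [ct ht] := pt.
(* The first summand bounds the accumulator; the second is the time bound of [G] at the sizes of the
   parameter, the accumulator and an element no larger than the whole list. *)
pose M (x : X) := let n := @sz X eX x in n.+2 ^ c + (n + n.+2 ^ c + n.+2 ^ cl + 2).+2 ^ ct.
have pM : polyb (@sz X _) M.
  by rewrite /M; poly_tac.
exists (P ;; unpair ;; above unpair ;; fold_loop G ;; clear 0 ;; mv 2 1 ;; mv 1 0).
eexists; split; last first.
- move=> x; go (hP x); go (@run_unpair (en x) (Node (en (l x)) (en (a x)))).
  go (run_above _ (@run_unpair (en (l x)) (en (a x)))).
  eapply run_seq.
    apply: (@run_fold_loop g G (fun a y => t (x, a, y)) x (M x)) => // k b.
    have szb : sz b <= (sz x).+2 ^ c by exact: (hc (x, k)).
    split=> [|y szy]; first by rewrite /M; lia.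
    apply: leq_trans (ht _) _; apply: leq_trans (leq_addl _ _).
    have -> : (sz (x, b, y)).+2 = (sz x + sz b + sz y + 2).+2 by rewrite !sz_pair; lia.
    by case: (ct) => // n; rewrite leq_exp2r //; have := hl x; lia.
  by go run_clear; go run_mv; stop run_mv.
- exists c => x; have := hc (x, size (l x)); by rewrite /= take_size.
have pa : polyb sz (fun x => sz (a x)) by case: fa => ? [? []].
have pl : polyb sz (fun x => sz (l x)) by exists cl.
have pf : polyb sz (fun x => sz (foldl (g x) (a x) (l x))).
  by exists c => x; have := hc (x, size (l x)); rewrite /= take_size.
have psl : polyb sz (fun x => size (l x)).
  by apply: poly_le pl _ => x; apply/ltnW/size_sz.
apply: (@poly_le _ _ _ (fun x => tp x +
  (9 * sz x + 8 * (sz (l x) + sz (a x) + 1) + 6 + (9 * sz (l x) + 8 * sz (a x) + 6 +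
   (size (l x) * (M x + 9 * (sz x + M x + sz (l x) + M x) + 14) + 4 +
   (2 * sz x + 1 + (8 * sz (foldl (g x) (a x) (l x)) + 2))))))).
  by poly_tac.
by move=> x; rewrite /sz; sizes.
Qed.

(** If each step adds to the accumulator an amount that does not depend on it, the total growth is
    at most the number of steps times a polynomial. *)
Lemma fp_foldl (l : X -> seq Y) (a : X -> A) (g : X -> A -> Y -> A) (b : X * Y -> nat) :
    fp l -> fp a -> fp (fun p : X * A * Y => g p.1.1 p.1.2 p.2) ->
    polyb sz b -> (forall x a y, sz (g x a y) <= sz a + b (x, y)) ->
  fp (fun x => foldl (g x) (a x) (l x)).
Proof.
move=> fl fa fg [c hb] hg; apply: fp_foldl_take => //.
have [ca ha] : polyb sz (fun x => sz (a x)) by case: fa => ? [? []].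
have [cl hl] : polyb sz (fun x => sz (l x)) by case: fl => ? [? []].
have bound x s z : sz (foldl (g x) z s) <= sz z + size s * (sz x + sz s + 1).+2 ^ c.
  elim: s z => [|y s IH] z /=; first by lia.
  apply: leq_trans (IH _) _; have := hg x z y; have := hb (x, y); rewrite sz_pair sz_cons.
  have h1 : (sz x + sz y).+3 ^ c <= (sz x + (sz y + sz s).+1 + 1).+2 ^ c.
    by case: (c) => // n; rewrite leq_exp2r //; lia.
  have h2 : (sz x + sz s + 1).+2 ^ c <= (sz x + (sz y + sz s).+1 + 1).+2 ^ c.
    by case: (c) => // n; rewrite leq_exp2r //; lia.
  by move: h1 h2; move: (_ ^ c) => ?; move: (_ ^ c) => ?; move: (_ ^ c) => ?; nia.
have take_sz k (s : seq Y) : sz (take k s) <= sz s.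
  elim: s k => // y s IH [|k]; first by rewrite take0 sz_nil; exact: sz_gt0.
  by rewrite /= !sz_cons ltnS leq_add2l.
apply: (@poly_le _ _ _ (fun p => (sz p.1).+2 ^ ca +
   (sz p.1).+2 ^ cl * (sz p.1 + (sz p.1).+2 ^ cl + 1).+2 ^ c)); last first.
  move=> [x k] /=; apply: leq_trans (bound _ _ _) _.
  apply: leq_add; first exact: ha.
  apply: leq_mul.
    apply: leq_trans (hl x); apply: ltnW; apply: leq_ltn_trans (size_sz _).
    by rewrite size_take; case: ltnP => // /ltnW.
  have := leq_trans (take_sz k (l x)) (hl x).
  by case: (c) => // n h; rewrite leq_exp2r //; lia.
have ps : polyb (fun p : X * nat => sz p.1) (fun p => sz p.1) by exact: poly_measure.
by poly_tac.
Qed.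

End Foldl.

Definition isleaf t := if t is Leaf then true else false.
Definition left t := if t is Node a _ then a else Leaf.
Definition right t := if t is Node _ b then b else Leaf.

Lemma fp_size T U {eT : encodable T} {eU : encodable U} (f : T -> U) :
  fp f -> polyb sz (fun x => sz (f x)).
Proof. by case=> P [t []]. Qed.

Lemma fp_left0 : fp left.
Proof.
have [P [t [pt pf hP]]] := @fp_fst0 tree tree _ _.
exists (case 0 P skip skip).
exists (fun u => (if u is Node a b then t (a, b) else 1).+1).
have szN a b : sz (a, b) = sz (Node a b) by [].
split=> [||[|a b]].
- case: pt => c ht; apply: poly_succ; exists c.+1 => -[|a b]; first by rewrite expn_gt0.
  by apply: leq_trans (ht _) _; rewrite szN leq_exp2l.
- case: pf => c hf; exists c => -[|a b]; first by rewrite expn_gt0.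
  exact: (hf (a, b)).
- by apply: run_case; exact: run_skip.
- by apply: run_case; exact: (hP (a, b)).
Qed.

Lemma fp_right0 : fp right.
Proof.
have [P [t [pt pf hP]]] := @fp_snd0 tree tree _ _.
exists (case 0 P skip skip).
exists (fun u => (if u is Node a b then t (a, b) else 1).+1).
have szN a b : sz (a, b) = sz (Node a b) by [].
split=> [||[|a b]].
- case: pt => c ht; apply: poly_succ; exists c.+1 => -[|a b]; first by rewrite expn_gt0.
  by apply: leq_trans (ht _) _; rewrite szN leq_exp2l.
- case: pf => c hf; exists c => -[|a b]; first by rewrite expn_gt0.
  exact: (hf (a, b)).
- by apply: run_case; exact: run_skip.
- by apply: run_case; exact: (hP (a, b)).
Qed.

(** * Between raw strings and codes of trees *)

Definition quote_body k t := case t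
  (pop t ;; push k false ;; push k false ;; push k true ;; push k true)
  (pop t ;; push k false ;; push k true) skip.
(** Inputs of [runs] are raw strings, whereas [fp] expects codes. As an entry of a coded list the
    bit 1 reads 1100 and the bit 0 reads 10; the code is written from its end. *)
Definition quote k t := mv k t ;; push k false ;; while t (quote_body k t).

Ltac sets := repeat (rewrite ?nth_set_nth /= ?eqxx; match goal with
  | H : is_true (?a != ?b) |- context [?a == ?b] => rewrite (negPf H)
  | H : is_true (?a != ?b) |- context [?b == ?a] => rewrite [b == a]eq_sym (negPf H)
  | |- context [?a == ?b] => case: (eqVneq a b) => [?|?]; [subst|] end); rewrite ?nth_set_nth /= ?eqxx.

Lemma run_quote_loop k t x : k != t -> forall xs (y : seq bool),
    stk xs t = x -> stk xs k = pre (en y) ->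
  run (while t (quote_body k t)) xs (7 * size x + 1)
    (setstk (setstk xs k (pre (en (catrev x y)))) t [::]).
Proof.
move=> kt; elim: x => [|b x IH] xs y ex ey.
  apply: run_eq; first exact: run_while0.
  by move=> j; sets; rewrite ?ex ?ey.
set ys := setstk (setstk xs k (pre (en (b :: y)))) t x.
apply: (run_le (n := (6 + (7 * size x + 1)).+1)); last by rewrite /=; lia.
apply: (@run_whileS _ _ _ _ ys); first by rewrite ex.
  apply: run_case; rewrite ex /ys; case: b {IH ys} ex => ex; apply: run_le.
  - apply: (run_seq (run_pop _ _)); do 3![apply: (run_seq (run_push _ _ _))].
    apply: run_eq; first exact: run_push.
    by move=> j; sets; rewrite ?ex ?ey.
  - by [].
  - apply: (run_seq (run_pop _ _)); apply: (run_seq (run_push _ _ _)).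
    apply: run_eq; first exact: run_push.
    by move=> j; sets; rewrite ?ex ?ey.
  - by [].
apply: run_ext (IH ys (b :: y) _ _) => //; rewrite /ys.
- by move=> j; sets.
- by sets.
- by sets.
Qed.

Lemma run_quote k t (x : seq bool) xs : k != t -> stk xs k = x -> stk xs t = [::] ->
  run (quote k t) xs (11 * size x + 3) (setstk xs k (pre (en x))).
Proof.
move=> kt ek et; apply: run_le.
  apply: (run_seq (run_mv _ kt)); apply: (run_seq (run_push _ _ _)).
  apply: run_eq; first apply: (run_quote_loop (x := rev x) (y := [::]) kt).
  - by sets; rewrite ek et.
  - by sets.
  - by move=> j; rewrite (revK x : catrev (rev x) [::] = x); sets.
by rewrite ek size_rev; lia.
Qed.

Definition unquote := while 0 (case 0
  (pop 0 ;; case 0 (pop 0 ;; pop 0 ;; pop 0 ;; push 1 true) (pop 0 ;; push 1 false) skip)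
  (pop 0) skip) ;; mv 1 0.

Lemma run_unquote (x : seq bool) : run unquote [:: pre (en x)] (12 * size x + 6) [:: x].
Proof.
apply: run_le.
  apply: (@run_seq _ _ _ (8 * size x + 4) [:: [::]; rev x]); last by stop run_mv.
  apply: (@run_ext _ [:: pre (en x); [::]] _ _ [:: [::]; catrev x [::]]) => [|//|].
    by do 3?case.
  set W := while 0 _; have h : forall y : seq bool, run W [:: pre (@en (seq bool) _ x); y] (8 * size x + 4) [:: [::]; catrev x y]; last exact: h.
  rewrite /W; elim: x => [|b x IH] y.
    apply: (run_le (n := (2 + 1).+1)) => //.
    apply: run_whileS => //; last by apply: run_while0.
    by apply: run_case; apply: run_eq; [exact: run_pop | stks].
  apply: (run_le (n := (7 + (8 * size x + 4)).+1)); last by rewrite /=; lia.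
  apply: run_whileS => //; last exact: (IH (b :: y)).
  apply: run_case => /=; case: b {IH} => /=; apply: run_le.
  - go run_pop; apply: run_case => /=; do 3![go run_pop]; stop run_push.
  - by [].
  - go run_pop; apply: run_case => /=; go run_pop; stop run_push.
  - by [].
by rewrite /= size_rev; lia.
Qed.

(** The input stack already holds [pre (en x)] as a raw string, so it only has to be quoted. *)
Lemma fp_quote0 T {eT : encodable T} : fp (fun x : T => pre (en x)).
Proof.
exists (quote 0 1), (fun x => 11 * sz x + 3); split=> [||x]; first by poly_tac.
  by apply: poly_le (fun x => sz_bits (pre (en x))); poly_tac; exact: poly_measure.
by apply: run_eq; [exact: run_quote | case].
Qed.

Lemma runs_of_run O P xs n out ys c : run P xs n (out :: ys) -> n <= (sumn (map size xs)).+2 ^ c ->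
  runs O (P 0) (2 * c + 3 ^ c) xs out.
Proof.
move=> h le_n; have [m le_m e] := h O (fun=> [::]) 0.
exists m, (frame (fun=> [::]) 0 (out :: ys)); split=> //; first by rewrite -(frame0 (fun=> [::])).
exact: leq_trans le_m (leq_trans le_n (poly_runs _ _)).
Qed.

Lemma fp_run1 (f : seq bool -> seq bool) : fp f -> exists P c, forall x,
  exists2 n, n <= (size x).+2 ^ c & run P [:: x] n [:: f x].
Proof.
move=> [P [t [pt pf hP]]].
have [e he] : polyb size (fun x => 11 * size x + 3 + (t x + (12 * size (f x) + 6))).
  have sx : polyb size (fun x : seq bool => sz x).
    by apply: poly_le (fun x => sz_bits x); poly_tac.
  poly_tac; first exact: (@poly_comp _ _ _ _ t (fun x => x) pt sx).
  apply: (@poly_le _ _ _ (fun x => sz (f x))); last by move=> x; exact/ltnW/size_sz.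
  exact: (@poly_comp _ _ _ _ (fun x => sz (f x)) (fun x => x) pf sx).
exists (quote 0 1 ;; P ;; unquote), e => x; eexists; first exact: (he x).
by go run_quote; go (hP x); exact: run_unquote.
Qed.

Lemma fp_run3 (f : seq bool * seq bool * seq bool -> seq bool) : fp f ->
  exists P c, forall x y z,
  exists2 n, n <= (size x + size y + size z).+2 ^ c & run P [:: x; y; z] n [:: f (x, y, z)].
Proof.
move=> [P [t [pt pf hP]]].
pose m (p : seq bool * seq bool * seq bool) := size p.1.1 + size p.1.2 + size p.2.
have sp : polyb m (fun p => sz p).
  apply: (@poly_le _ _ _ (fun p => 20 * m p + 20)); first by poly_tac.
  move=> [[x y] z]; rewrite !sz_pair /m /=.
  by have := sz_bits x; have := sz_bits y; have := sz_bits z; lia.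
have [e he] : polyb m (fun p => 100 * m p + 100 + (100 * sz p + 100 + (t p + (12 * size (f p) + 6)))).
  poly_tac; first exact: (@poly_comp _ _ _ _ t (fun x => x) pt sp).
  apply: (@poly_le _ _ _ (fun x => sz (f x))); last by move=> x; exact/ltnW/size_sz.
  exact: (@poly_comp _ _ _ _ (fun x => sz (f x)) (fun x => x) pf sp).
exists (quote 0 3 ;; quote 1 3 ;; quote 2 3 ;; 
  (mv 1 3 ;; mv 3 2 ;; mv 0 3 ;; mv 3 2 ;; push 2 true ;; push 2 true ;; mv 2 3 ;; mv 3 0) ;;
  P ;; unquote), e => x y z.
eexists; first exact: (he (x, y, z)).
have run_go : run (mv 1 3 ;; mv 3 2 ;; mv 0 3 ;; mv 3 2 ;; push 2 true ;; push 2 true ;;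
    mv 2 3 ;; mv 3 0) [:: pre (en x); pre (en y); pre (en z)]
    (16 * (sz x + sz y + sz z) + 24) [:: pre (en (x, y, z))].
  apply: run_le.
    do 4![go run_mv]; do 2![go run_push]; go run_mv; stop run_mv; rewrite ?catA //.
  by rewrite /sz; sizes.

apply: run_le.
  go run_quote; go run_quote; go run_quote; go run_go; go (hP (x, y, z)); exact: run_unquote.
by rewrite !sz_pair /m /=; lia.
Qed.

Section Structural.
Context {T U V : Type} {eT : encodable T} {eU : encodable U} {eV : encodable V}.

Lemma fp_fst (f : T -> U * V) : fp f -> fp (fun x => (f x).1).
Proof. by move=> hf; exact: fp_comp hf fp_fst0. Qed.

Lemma fp_snd (f : T -> U * V) : fp f -> fp (fun x => (f x).2).
Proof. by move=> hf; exact: fp_comp hf fp_snd0. Qed.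

Lemma fp_cons (f : T -> U) (g : T -> seq U) : fp f -> fp g -> fp (fun x => f x :: g x).
Proof.
by move=> hf hg; apply: (fp_conv (h := id) _ _ (fp_pair hf hg)).
Qed.

Lemma fp_nilp (f : T -> seq U) : fp f -> fp (fun x => nilp (f x)).
Proof.
move=> hf; apply: fp_eq (fp_if_leaf hf (fp_const true) (fp_const false)) => x.
by case: (f x).
Qed.

Lemma fp_head d (f : T -> seq U) : en d = Leaf -> fp f -> fp (fun x => head d (f x)).
Proof.
move=> hd hf; apply: (fp_comp hf).
apply: (fp_conv (h := en) _ _ fp_left0) => // -[] //=.
Qed.

Lemma fp_behead (f : T -> seq U) : fp f -> fp (fun x => behead (f x)).
Proof.
move=> hf; apply: (fp_comp hf).
by apply: (fp_conv (h := en) _ _ fp_right0) => // -[].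
Qed.

Lemma fp_left (f : T -> tree) : fp f -> fp (fun x => left (f x)).
Proof. by move=> hf; exact: fp_comp hf fp_left0. Qed.

Lemma fp_right (f : T -> tree) : fp f -> fp (fun x => right (f x)).
Proof. by move=> hf; exact: fp_comp hf fp_right0. Qed.

Lemma fp_node (f g : T -> tree) : fp f -> fp g -> fp (fun x => Node (f x) (g x)).
Proof.
by move=> hf hg; apply: (fp_conv (h := id) _ _ (fp_pair hf hg)).
Qed.

Lemma fp_isleaf (f : T -> tree) : fp f -> fp (fun x => isleaf (f x)).
Proof.
move=> hf; apply: fp_eq (fp_if_leaf hf (fp_const true) (fp_const false)) => x.
by rewrite /en /tree_enc; case: (f x).
Qed.

Lemma fp_pre (f : T -> U) : fp f -> fp (fun x => pre (en (f x))).
Proof. by move=> hf; exact: fp_comp hf fp_quote0. Qed.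

Lemma fp_neg (f : T -> bool) : fp f -> fp (fun x => ~~ f x).
Proof.
by move=> hf; apply: fp_eq (fp_if hf (fp_const false) (fp_const true)) => x; case: (f x).
Qed.

Lemma fp_and (f g : T -> bool) : fp f -> fp g -> fp (fun x => f x && g x).
Proof.
by move=> hf hg; apply: fp_eq (fp_if hf hg (fp_const false)) => x; case: (f x).
Qed.

Lemma fp_or (f g : T -> bool) : fp f -> fp g -> fp (fun x => f x || g x).
Proof.
by move=> hf hg; apply: fp_eq (fp_if hf (fp_const true) hg) => x; case: (f x).
Qed.

End Structural.

(* A hook of [fp_tac], redefined as further closure lemmas are proved. *)
Ltac fp_more := fail.

Ltac fp_tac := repeat match goal with
  | |- fp (fun x => x) => exact: fp_id
  | |- fp fst => exact: fp_fst0
  | |- fp snd => exact: fp_snd0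
  | |- fp (fun x => ?c) => exact: fp_const
  | |- fp (fun x => (@?f x, @?g x)) => apply: (fp_pair (f := f) (g := g))
  | |- fp (fun x => fst (@?f x)) => apply: (fp_fst (f := f))
  | |- fp (fun x => snd (@?f x)) => apply: (fp_snd (f := f))
  | |- fp (fun x => @?f x :: @?g x) => apply: (fp_cons (f := f) (g := g))
  | |- fp (fun x => nilp (@?f x)) => apply: (fp_nilp (f := f))
  | |- fp (fun x => head _ (@?f x)) => apply: (fp_head (f := f)); first done
  | |- fp (fun x => behead (@?f x)) => apply: (fp_behead (f := f))
  | |- fp (fun x => left (@?f x)) => apply: (fp_left (f := f))
  | |- fp (fun x => right (@?f x)) => apply: (fp_right (f := f))
  | |- fp (fun x => Node (@?f x) (@?g x)) => apply: (fp_node (f := f) (g := g))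
  | |- fp (fun x => isleaf (@?f x)) => apply: (fp_isleaf (f := f))
  | |- fp (fun x => pre (en (@?f x))) => apply: (fp_pre (f := f))
  | |- fp (fun x => ~~ (@?f x)) => apply: (fp_neg (f := f))
  | |- fp (fun x => (@?f x) && (@?g x)) => apply: (fp_and (f := f) (g := g))
  | |- fp (fun x => (@?f x) || (@?g x)) => apply: (fp_or (f := f) (g := g))
  | |- fp (fun x => if _ then _ else _) => apply: fp_if
  | _ => first [ assumption | fp_more ]
  end.

Lemma sz_leaf : sz Leaf = 1. Proof. by []. Qed.
Lemma sz_node a b : sz (Node a b) = (sz a + sz b).+1. Proof. exact: sz_pair. Qed.
Lemma sz_true : sz true = 3. Proof. by []. Qed.
Lemma sz_false : sz false = 1. Proof. by []. Qed.

Lemma sz_catrev T {eT : encodable T} (s t : seq T) : sz (catrev s t) + 1 = sz s + sz t.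
Proof.
by elim: s t => [|x s IH] t; [rewrite sz_nil addnC | rewrite /= IH !sz_cons; lia].
Qed.

Lemma sz_cat T {eT : encodable T} (s t : seq T) : sz (s ++ t) + 1 = sz s + sz t.
Proof.
by elim: s t => [|x s IH] t; [rewrite sz_nil addnC | rewrite /= !sz_cons; have := IH t; lia].
Qed.

Lemma sz_rev T {eT : encodable T} (s : seq T) : sz (rev s) = sz s.
Proof. by apply: (@addIn 1); rewrite sz_catrev sz_nil. Qed.

Lemma sz_behead T {eT : encodable T} (s : seq T) : sz (behead s) <= sz s.
Proof. by case: s => // x s; rewrite sz_cons /=; lia. Qed.

Lemma foldl_cons T (s t : seq T) : foldl (fun a y => y :: a) t s = catrev s t.
Proof. by elim: s t => //=. Qed.

Section Lists.
Context {T U V : Type} {eT : encodable T} {eU : encodable U} {eV : encodable V}.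

Lemma poly_snd : polyb (@sz (T * U) _) (fun p => sz p.2).
Proof. by apply: poly_le (poly_measure _) _ => -[x y]; rewrite sz_pair /=; lia. Qed.

Lemma fp_catrev (f g : T -> seq U) : fp f -> fp g -> fp (fun x => catrev (f x) (g x)).
Proof.
move=> hf hg; apply: fp_eq (fun x => foldl_cons _ _) _.
apply: (fp_foldl (b := fun p => (sz p.2).+1) (g := fun _ a y => y :: a)) => //.
- by fp_tac.
- by apply: poly_succ; exact: poly_snd.
- by move=> x a y; rewrite sz_cons /=; lia.
Qed.

End Lists.

(** * String functions of the network as left folds *)

Definition dec_step (st : bool * (seq bool * seq (seq bool))) (b : bool) :=
  if st.1 then (false, (b :: st.2.1, st.2.2))
  else if b then (true, st.2) else (false, ([::], rev st.2.1 :: st.2.2)).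

(** The state of the fold records whether a continuation bit has just been read, the current item
    and the finished items, the last two reversed. *)
Definition dec (s : seq bool) := rev (foldl dec_step (false, ([::], [::])) s).2.2.

Lemma decK xs : dec (enc_list xs) = xs.
Proof.
rewrite /dec; suff h ys : (foldl dec_step (false, ([::], ys)) (enc_list xs)).2.2 = rev xs ++ ys.
  by rewrite h cats0 revK.
elim: xs ys => //= x xs IH ys; rewrite /enc_list /= foldl_cat.
have hx c : foldl dec_step (false, (c, ys)) (rcons (flatten [seq [:: true; b] | b <- x]) false) =
    (false, ([::], (rev c ++ x) :: ys)).
  elim: x c => [|b x IHx] c /=; first by rewrite cats0.
  by rewrite [dec_step (false, _) true]/dec_step [dec_step _ b]/dec_step /= IHx rev_cons cat_rcons.
rewrite hx /=.
by rewrite IH rev_cons cat_rcons.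
Qed.

Definition orl (a b : seq bool) :=
  let st := foldl (fun st x => (behead st.1, (x || head false st.1) :: st.2)) (b, [::]) a in
  catrev st.2 st.1.

(** The monoid laws are read off from this positionwise form. Lengths have to be tracked too,
    because trailing zeros distinguish strings. *)
Lemma orlE a b : orl a b = mkseq (fun i => nth false a i || nth false b i) (maxn (size a) (size b)).
Proof.
pose F := fun st x => (behead st.1, (x || head false st.1) :: st.2) : seq bool * seq bool.
have h c d : let st := foldl F (d, c) a in catrev st.2 st.1 =
    catrev c (mkseq (fun i => nth false a i || nth false d i) (maxn (size a) (size d))).
  elim: a c d => [|x a IH] c d /=.
    rewrite max0n -{1}[d](mkseq_nth false); congr (catrev c _).
    by apply: eq_map => i; rewrite nth_nil.
  rewrite IH /=; congr (catrev c _).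
  have -> : maxn (size a).+1 (size d) = (maxn (size a) (size (behead d))).+1.
    by rewrite size_behead; case: (size d) => [|n] /=; rewrite ?maxnSS // maxn0.
  rewrite /mkseq /= -[1]addn0 iotaDl -map_comp; rewrite nth0; congr (_ :: _).
  by apply: eq_map => i /=; rewrite nth_behead.
exact: (h [::] b).
Qed.

Lemma size_orl a b : size (orl a b) = maxn (size a) (size b).
Proof. by rewrite orlE size_mkseq. Qed.

Lemma nth_orl a b i : nth false (orl a b) i = nth false a i || nth false b i.
Proof.
rewrite orlE; case: (ltnP i (maxn (size a) (size b))) => hi; first by rewrite nth_mkseq.
rewrite nth_default ?size_mkseq //; move: hi; rewrite geq_max => /andP [ha hb].
by rewrite !nth_default.
Qed.

Lemma orl_ext a b c d : maxn (size a) (size b) = maxn (size c) (size d) ->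
  (forall i, nth false a i || nth false b i = nth false c i || nth false d i) ->
  orl a b = orl c d.
Proof. by move=> e h; rewrite !orlE e; apply: eq_map. Qed.

Lemma orlC : commutative orl.
Proof. by move=> a b; apply: orl_ext; [rewrite maxnC | move=> i; rewrite orbC]. Qed.

Lemma orlA : associative orl.
Proof.
move=> a b c; apply: orl_ext; first by rewrite !size_orl maxnA.
by move=> i; rewrite !nth_orl orbA.
Qed.

Lemma or0l a : orl [::] a = a.
Proof. by []. Qed.

Fixpoint thin (T : Type) (b : bool) (s : seq T) :=
  if s is x :: s' then (if b then cons x else id) (thin (~~ b) s') else [::].

Lemma nth_thin (T : Type) (d : T) b s i :
  nth d (thin b s) i = nth d s (i.*2 + ~~ b).
Proof.
elim: s b i => [|x s IH] [] i; rewrite ?nth_nil //.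
  by case: i => [|i] //; rewrite [LHS]IH addn0 doubleS addn1.
by rewrite [LHS]IH addn0 addn1.
Qed.

(** Indexing by a binary number, low bit first: each bit keeps the positions of its parity. The
    index is never counted down in unary. *)
Definition sel (s : seq (seq bool)) (v : seq bool) :=
  head [::] (foldl (fun s b => thin (~~ b) s) s v).

Lemma sel_nat s v : sel s (enc_nat v) = nth [::] s v.
Proof.
rewrite /sel /enc_nat -nth0; case: v => [|v] //; set n := v.+1.
case e: (N.of_nat n) => [|p]; first by have := Nat2N.id n; rewrite e.
have {e} <- : N.to_nat (Npos p) = n by rewrite -e Nat2N.id.
rewrite /=; elim: p s => [p IH|p IH|] s /=.
- rewrite IH nth_thin /= Pos2Nat.inj_xI; congr nth; lia.
- rewrite IH nth_thin /= Pos2Nat.inj_xO; congr nth; lia.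
- by rewrite nth_thin.
Qed.

Definition thinl (T : Type) b (s : seq T) :=
  rev (foldl (fun st y => (~~ st.1, if st.1 then y :: st.2 else st.2)) (b, [::]) s).2.

Lemma thinlE (T : Type) b (s : seq T) : thinl b s = thin b s.
Proof.
pose F := fun st y => (~~ st.1, if st.1 then y :: st.2 else st.2) : bool * seq T.
suff h c : (foldl F (b, c) s).2 = catrev (thin b s) c by rewrite /thinl -/F h revK.
by elim: s b c => [|x s IH] [] c //=; rewrite IH.
Qed.

(** Read backwards, a prefix code is reverse Polish notation, so a stack of trees suffices to parse
    it. Reversed, the code of a node also ends with 1, as a numeral with low bit first must. *)
Definition parse_step (st : seq tree) (b : bool) :=
  if b then Node (head Leaf st) (head Leaf (behead st)) :: behead (behead st) else Leaf :: st.

Definition parse_tree (s : seq bool) := head Leaf (foldl parse_step [::] s).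

Lemma parse_treeK t : parse_tree (rev (pre t)) = t.
Proof.
rewrite /parse_tree; suff -> : foldl parse_step [::] (rev (pre t)) = [:: t] by [].
elim: t [::] => [|a IHa b IHb] st //=.
by rewrite rev_cons rev_cat -cats1 !foldl_cat IHb IHa.
Qed.

Section Fp.
Context {T U : Type} {eT : encodable T} {eU : encodable U}.

Lemma fp_rev (f : T -> seq U) : fp f -> fp (fun x => rev (f x)).
Proof. by move=> hf; apply: fp_catrev hf (fp_const [::]). Qed.

Lemma fp_cat (f g : T -> seq U) : fp f -> fp g -> fp (fun x => f x ++ g x).
Proof.
move=> hf hg; apply: (@fp_eq _ _ _ _ (fun x => catrev (rev (f x)) (g x))).
  by move=> x; rewrite catrevE revK.
by apply: fp_catrev hg; apply: fp_rev.
Qed.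

End Fp.

Ltac fp_more ::= match goal with
  | |- fp (fun x => rev (@?f x)) => apply: (fp_rev (f := f))
  | |- fp (fun x => @?f x ++ @?g x) => apply: (fp_cat (f := f) (g := g))
  end.

Section Raw.
Context {T U : Type} {eT : encodable T} {eU : encodable U}.

Lemma fp_dec (f : T -> seq bool) : fp f -> fp (fun x => dec (f x)).
Proof.
move=> hf; rewrite /dec; fp_tac.
apply: (fp_foldl (b := fun p => sz p.2 + 10) (g := fun _ => dec_step)) => //.
- exact: fp_const.
- by rewrite /dec_step; fp_tac.
- by apply: poly_add; [exact: poly_snd | exact: poly_const].
move=> x [p [c it]] y; rewrite /dec_step /=; have := sz_gt0 c; have := sz_gt0 y.
by case: p y => [] []; rewrite !(sz_pair, sz_cons, sz_rev, sz_nil, sz_true, sz_false) /=; lia.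
Qed.

Lemma fp_orl (f g : T -> seq bool) : fp f -> fp g -> fp (fun x => orl (f x) (g x)).
Proof.
move=> hf hg; rewrite /orl.
pose F := fun (_ : T) st x => (behead st.1, (x || head false st.1) :: st.2) : seq bool * seq bool.
have hF : fp (fun x => foldl (F x) (g x, [::]) (f x)).
  apply: (fp_foldl (b := fun p => 10)) => //.
  - by fp_tac.
  - by rewrite /F; fp_tac.
  - exact: poly_const.
  move=> x [c d] y; rewrite /F /= !sz_pair sz_cons.
  have h : sz (behead c) <= sz c by exact: sz_behead.
  by have := sz_bool (y || head false c); lia.
by apply: fp_catrev; [apply: fp_snd | apply: fp_fst].
Qed.

Lemma fp_thin (b : T -> bool) (f : T -> seq U) :
  fp b -> fp f -> fp (fun x => thin (b x) (f x)).
Proof.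
move=> hb hf; apply: fp_eq (fun x => thinlE (b x) (f x)) _.
apply: fp_rev; apply: fp_snd.
pose F := fun (_ : T) st y => (~~ st.1, if st.1 then y :: st.2 else st.2) : bool * seq U.
apply: (fp_foldl (b := fun p => sz p.2 + 10) (g := F)) => //.
- by fp_tac.
- by rewrite /F; fp_tac.
- by apply: poly_add; [exact: poly_snd | exact: poly_const].
by move=> x [[] c] y; rewrite /F /= !sz_pair ?(sz_cons, sz_true, sz_false) /=; lia.
Qed.

Lemma sz_thin b (s : seq U) : sz (thin b s) <= sz s.
Proof.
by elim: s b => [|x s IH] [] //=; rewrite ?sz_cons; have := IH true; have := IH false; lia.
Qed.

End Raw.

Section Fp.
Context {T : Type} {eT : encodable T}.

Lemma fp_sel (f : T -> seq (seq bool)) g : fp f -> fp g -> fp (fun x => sel (f x) (g x)).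
Proof.
move=> hf hg; rewrite /sel; fp_tac.
apply: (fp_foldl (b := fun p => 0) (g := fun _ s b => thin (~~ b) s)) => //.
- by apply: fp_thin; fp_tac.
- exact: poly_const.
by move=> x s b; rewrite addn0; exact: sz_thin.
Qed.

Lemma fp_parse (f : T -> seq bool) : fp f -> fp (fun x => parse_tree (f x)).
Proof.
move=> hf; rewrite /parse_tree; fp_tac.
apply: (fp_foldl (b := fun p => 10) (g := fun _ => parse_step)) => //.
- exact: fp_const.
- by rewrite /parse_step; fp_tac.
- exact: poly_const.
move=> x s y; rewrite /parse_step; case: y; last by rewrite sz_cons sz_leaf; lia.
by case: s => [|a [|b s]] //=; rewrite !(sz_cons, sz_node, sz_leaf, sz_nil); lia.
Qed.

End Fp.

Ltac fp_more ::= match goal with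
  | |- fp (fun x => rev (@?f x)) => apply: (fp_rev (f := f))
  | |- fp (fun x => @?f x ++ @?g x) => apply: (fp_cat (f := f) (g := g))
  | |- fp (fun x => dec (@?f x)) => apply: (fp_dec (f := f))
  | |- fp (fun x => orl (@?f x) (@?g x)) => apply: (fp_orl (f := f) (g := g))
  | |- fp (fun x => sel (@?f x) (@?g x)) => apply: (fp_sel (f := f) (g := g))
  | |- fp (fun x => parse_tree (@?f x)) => apply: (fp_parse (f := f))
  end.

(** * A universal machine *)

(* Pending instructions, and the stacks as a zipper. *)
Definition mstate := (seq tree * (seq tree * tree * seq tree))%type.

(** The opcode is unary along right children, so that instructions can be told apart with [right]
    and [isleaf] alone. *)
Definition instr n (a : tree) := Node (iter n (Node Leaf) Leaf) a.

(** Projections and tests instead of pattern matching keep this within reach of [fp_tac]. A state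
    without pending instructions is a fixed point, so running on after the halt does no harm. *)
Definition step (s : mstate) : mstate :=
  if nilp s.1 then s else
  if isleaf (left (head Leaf s.1)) then
    (left (right (head Leaf s.1)) :: right (right (head Leaf s.1)) :: behead s.1, s.2)
  else if isleaf (right (left (head Leaf s.1))) then
    (behead s.1, (s.2.1.2 :: s.2.1.1, head Leaf s.2.2, behead s.2.2))
  else if isleaf (right (right (left (head Leaf s.1)))) then
    (behead s.1, (behead s.2.1.1, head Leaf s.2.1.1, s.2.1.2 :: s.2.2))
  else if isleaf (right (right (right (left (head Leaf s.1))))) then
    (behead s.1, (s.2.1.1, Node (right (head Leaf s.1)) s.2.1.2, s.2.2))
  else if isleaf (right (right (right (right (left (head Leaf s.1)))))) then
    (behead s.1, (s.2.1.1, right s.2.1.2, s.2.2))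
  else if isleaf (right (right (right (right (right (left (head Leaf s.1))))))) then
    ((if isleaf s.2.1.2 then right (right (right (head Leaf s.1)))
      else if isleaf (left s.2.1.2) then left (right (right (head Leaf s.1)))
      else left (right (head Leaf s.1))) :: behead s.1, s.2)
  else if isleaf (right (right (right (right (right (right (left (head Leaf s.1)))))))) then
    (if isleaf s.2.1.2 then behead s.1 else right (head Leaf s.1) :: s.1, s.2)
  else if isleaf (right (right (right (right (right (right (right (left (head Leaf s.1)))))))))
  then (behead s.1, (s.2.1.1, Leaf, s.2.2))
  else (behead s.1, s.2).

Notation iseq a b := (instr 0 (Node a b)).
Notation iright := (instr 1 Leaf).
Notation ileft := (instr 2 Leaf).
Notation ipush b := (instr 3 (en b)).
Notation ipop := (instr 4 Leaf).
Notation icase a b c := (instr 5 (Node a (Node b c))).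
Notation iwhile a := (instr 6 a).
Notation iclear := (instr 7 Leaf).
Notation inop := (instr 8 Leaf).

Definition rights i := iter i (fun t => iseq iright t) inop.
Definition lefts i := iter i (fun t => iseq ileft t) inop.
Definition at_stack i t := iseq (rights i) (iseq t (lefts i)).

(** The zipper rests at stack 0 between instructions. A test happens at stack [i], so the way back
    is placed inside the branches and at the start of the loop body. A query is answered no, in
    agreement with [no_oracle]. *)
Fixpoint compile (p : prog) : tree :=
  match p with
  | Skip => inop
  | Push i b => at_stack i (ipush b)
  | Pop i => at_stack i ipop
  | Seq p q => iseq (compile p) (compile q)
  | Case i pT pF pE => iseq (rights i)
      (icase (iseq (lefts i) (compile pT)) (iseq (lefts i) (compile pF))
         (iseq (lefts i) (compile pE)))
  | While i p => at_stack i (iwhile (iseq (lefts i) (iseq (compile p) (rights i))))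
  | Query i => at_stack i (iseq iclear (ipush false))
  end.

(** The default [Leaf] is the code of an empty stack, so a finite zipper represents the whole
    store. *)
Definition zip_at i (s : store) (D : seq tree * tree * seq tree) :=
  [/\ D.1.1 = rev (mkseq (fun j => en (s j)) i), D.1.2 = en (s i) &
      forall j, nth Leaf D.2 j = en (s (i + j).+1)].

Definition reach n (s s' : mstate) := exists2 m, m <= n & iter m step s = s'.

Lemma reach_le n n' s s' : reach n s s' -> n <= n' -> reach n' s s'.
Proof. by case=> m le_m <- le_n; exists m => //; apply: leq_trans le_m le_n. Qed.

Lemma reach0 s : reach 0 s s.
Proof. by exists 0. Qed.

Lemma reachS n s s' : reach n (step s) s' -> reach n.+1 s s'.
Proof. by case=> m le_m <-; exists m.+1; rewrite ?ltnS // iterSr. Qed.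

Lemma reach_trans n n' s s' s'' : reach n s s' -> reach n' s' s'' -> reach (n + n') s s''.
Proof.
by move=> [m le_m <-] [m' le_m' <-]; exists (m + m'); [exact: leq_add | rewrite addnC iterD].
Qed.

Lemma reach_rights i k s K D : zip_at k s D ->
  exists2 D', zip_at (k + i) s D' & reach (2 * i + 1) (rights i :: K, D) (K, D').
Proof.
elim: i k D => [|i IH] k D zD.
  by exists D; [rewrite addn0 | apply/reachS/reach0].
case: D zD => [[L c] R] [/= eL ec eR].
have [|D' zD' rD'] := IH k.+1 (c :: L, head Leaf R, behead R).
  split=> /=; first by rewrite mkseqS rev_rcons ec eL.
    by rewrite -nth0 eR addn0.
  by move=> j; rewrite nth_behead eR addnS.
exists D'; first by rewrite -addSnnS.
apply: (@reach_le (2 * i + 1).+2); last by lia.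
by apply: reachS; apply: reachS.
Qed.

Lemma reach_lefts i s K D : zip_at i s D ->
  exists2 D', zip_at 0 s D' & reach (2 * i + 1) (lefts i :: K, D) (K, D').
Proof.
elim: i D => [|i IH] D zD.
  by exists D; [ | apply/reachS/reach0].
case: D zD => [[L c] R] [/= eL ec eR].
have [|D' zD' rD'] := IH (behead L, head Leaf L, c :: R).
  split=> /=; rewrite ?eL ?mkseqS ?rev_rcons //.
  by case=> [|j] /=; rewrite ?ec ?eR ?addn0 ?addSnnS.
exists D' => //.
apply: (@reach_le (2 * i + 1).+2); last by lia.
by apply: reachS; apply: reachS.
Qed.

Lemma zip_upd i s L c R x : zip_at i s (L, c, R) -> zip_at i (upd s i x) (L, en x, R).
Proof.
case=> /= -> _ eR; split=> //=; last 2 first.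
- by rewrite /upd eqxx.
- by move=> j; rewrite eR /upd; case: eqP => //; lia.
congr rev; apply/eq_in_map => j; rewrite mem_iota /upd => hj.
by case: eqP => //; lia.
Qed.

(** Machine steps per program step. This depends on the program alone, because the zipper moves only
    as far as the stack numbers occurring in it. *)
Fixpoint slowdown (p : prog) : nat :=
  match p with
  | Seq p q => slowdown p + slowdown q + 1
  | Case i a b c => slowdown a + slowdown b + slowdown c + 4 * i + 10
  | While i p => slowdown p + 8 * i + 20
  | Push i _ | Pop i | Query i => 4 * i + 10
  | Skip => 1
  end.

Lemma exec_gt0 O p s t s' : exec O p s t s' -> 0 < t.
Proof. by elim=> //; lia. Qed.

Lemma reach_at_stack i t n s s' K D : zip_at 0 s D ->
    (forall K D, zip_at i s D -> exists2 D', zip_at i s' D' & reach n (t :: K, D) (K, D')) ->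
  exists2 D', zip_at 0 s' D' & reach (n + 4 * i + 4) (at_stack i t :: K, D) (K, D').
Proof.
move=> zD h; have [D1 zD1 r1] := reach_rights i (iseq t (lefts i) :: K) zD.
have [D2 zD2 r2] := h (lefts i :: K) D1 zD1; have [D3 zD3 r3] := reach_lefts K zD2.
exists D3 => //.
apply: (@reach_le (((2 * i + 1) + (n + (2 * i + 1)).+1).+1)); last by lia.
apply: reachS; apply: reach_trans r1 _; apply: reachS; exact: reach_trans r2 r3.
Qed.

Lemma compileP p s t s' : exec no_oracle p s t s' -> forall K D, zip_at 0 s D ->
  exists2 D', zip_at 0 s' D' & reach (slowdown p * t) (compile p :: K, D) (K, D').
Proof.
elim: p s t s' => [|i b|i|p IHp q IHq|i a IHa b IHb c IHc|i p IHp|i] s t s' e K D zD.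
- by inversion e; subst; exists D => //; apply/reachS/reach0.
- inversion e; subst; rewrite muln1.
  have [|D' zD' r] := @reach_at_stack i (ipush b) 1 s (upd s i (b :: s i)) K D zD; last first.
    by exists D' => //; apply: reach_le r _; rewrite /=; lia.
  move=> K' [[L c] R] z; exists (L, en (b :: s i), R); first exact: zip_upd z.
  by apply: reachS; case: z => _ /= -> _; exact: reach0.
- inversion e; subst; rewrite muln1.
  have [|D' zD' r] := @reach_at_stack i ipop 1 s (upd s i (behead (s i))) K D zD; last first.
    by exists D' => //; apply: reach_le r _; rewrite /=; lia.
  move=> K' [[L c] R] z; exists (L, en (behead (s i)), R); first exact: zip_upd z.
  by apply: reachS; case: z => _ /= -> _; rewrite /step /=; case: (s i) => *; exact: reach0.
- inversion e as [| | |? ? ? t1 s1 t2 ? e1 e2| | | | |]; subst.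
  have [D1 z1 r1] := IHp _ _ _ e1 (compile q :: K) D zD.
  have [D2 z2 r2] := IHq _ _ _ e2 K D1 z1.
  exists D2 => //; apply: (@reach_le (slowdown p * t1 + slowdown q * t2).+1).
    by apply: reachS; apply: reach_trans r1 r2.
  by have := exec_gt0 e1; rewrite /=; nia.
- inversion e as [| | | |? ? ? ? ? t1 ? e1| | | |]; subst.
  have [D1 z1 r1] := reach_rights i (icase (iseq (lefts i) (compile a))
    (iseq (lefts i) (compile b)) (iseq (lefts i) (compile c)) :: K) zD.
  rewrite add0n in z1.
  have [q eq r2] : exists2 q, q = branch (s i) a b c &
      forall n D', reach n (iseq (lefts i) (compile q) :: K, D1) (K, D') ->
      reach n.+1 (icase (iseq (lefts i) (compile a)) (iseq (lefts i) (compile b))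
        (iseq (lefts i) (compile c)) :: K, D1) (K, D').
    exists (branch (s i) a b c) => // n D' h; apply: reachS; move: h.
    by case: D1 z1 {r1} => [[L d] R] [/= _ -> _]; case: (s i) => [|[] x].
  have [D2 z2 r3] := reach_lefts (compile q :: K) z1.
  have [D3 z3 r4] : exists2 D3, zip_at 0 s' D3 &
      reach ((slowdown a + slowdown b + slowdown c) * t1) (compile q :: K, D2) (K, D3).
    move: e1; rewrite eq; case: (s i) => [|[] x] e1.
    + by have [D3 ? r] := IHc _ _ _ e1 K D2 z2; exists D3 => //; apply: reach_le r _; nia.
    + by have [D3 ? r] := IHa _ _ _ e1 K D2 z2; exists D3 => //; apply: reach_le r _; nia.
    + by have [D3 ? r] := IHb _ _ _ e1 K D2 z2; exists D3 => //; apply: reach_le r _; nia.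
  exists D3 => //.
  have r5 := reach_trans r3 r4.
  apply: reach_le; first by apply: reachS; apply: reach_trans r1 _; apply: r2;
    exact: (@reachS _ (iseq (lefts i) (compile q) :: K, D1) _ r5).
  by rewrite /=; nia.
- pose body := iseq (lefts i) (iseq (compile p) (rights i)).
  (* A loop needs an inner induction on the execution, in which the zipper rests at stack [i]
     instead of 0. *)
  have loop q s1 t1 s1' : exec no_oracle q s1 t1 s1' -> q = While i p ->
      forall K D, zip_at i s1 D -> exists2 D', zip_at i s1' D' &
      reach ((slowdown p + 4 * i + 10) * t1) (iwhile body :: K, D) (K, D').
    move=> {}e; elim: e => {s1 t1 s1' q} //.
    + move=> j q s1 s10 [? ?] K' D' zD'; subst; exists D' => //.
      apply: (@reach_le 1); last by lia.
      by apply: reachS; rewrite /step /=; case: zD' => _ -> _; rewrite s10; exact: reach0.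
    + move=> j q s1 t1 s2 t2 s3 sN e1 _ _ IH [? ?] K' D' zD'; subst.
      have [D1 z1 r1] := reach_lefts (iseq (compile p) (rights i) :: iwhile body :: K') zD'.
      have [D2 z2 r2] := IHp _ _ _ e1 (rights i :: iwhile body :: K') D1 z1.
      have [D3 z3 r3] := reach_rights i (iwhile body :: K') z2.
      have [D4 z4 r4] := IH erefl K' D3 z3.
      exists D4 => //; have r5 := reach_trans r2 (reach_trans r3 r4).
      have r6 := @reachS _ (body :: iwhile body :: K', D') _ (reach_trans r1
        (@reachS _ (iseq (compile p) (rights i) :: iwhile body :: K', D1) _ r5)).
      apply: reach_le; first apply: reachS.
        rewrite /step /=; case: (D') zD' r6 => [[L c] R] [/= _ -> _] r6.
        case: (s1 i) sN r6 => // b x _ r6; exact: r6.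
      by rewrite /=; nia.
  have [|D' z r] := @reach_at_stack i (iwhile body) ((slowdown p + 4 * i + 10) * t) s s' K D zD.
    by move=> K' D' zD'; exact: (loop _ _ _ _ e erefl).
  exists D' => //; apply: reach_le r _; have := exec_gt0 e; rewrite /=; nia.
- have [|D' z r] := @reach_at_stack i (iseq iclear (ipush false)) 3 s (upd s i [:: false]) K D zD.
    move=> K' [[L c] R] zD'; exists (L, en [:: false], R); first exact: zip_upd zD'.
    by do 3!apply: reachS; exact: reach0.
  inversion e; subst; first by [].
  by exists D' => //; apply: reach_le r _; rewrite /=; lia.
Qed.

Definition spine := fix spine (t : tree) : seq tree :=
  if t is Node a b then a :: spine b else [::].

(** Every tree codes some list of trees, so any feature whatsoever supplies a clock. *)
Lemma en_spine t : en (spine t) = t.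
Proof. by elim: t => //= a _ b IH; congr (Node _ _); exact: IH. Qed.

Definition machine_init (t : tree) (w : seq bool) : mstate :=
  ([:: left t], ([::], left (right t), [:: en w])).

(* The code, the first input and the number of steps are given by [t]. *)
Definition machine_run (t : tree) (w : seq bool) : mstate :=
  foldl (fun s _ => step s) (machine_init t w) (spine (right (right t))).

(** The machine has halted, and the top bit of the current stack is 1, which is coded by a node. *)
Definition accept t w := nilp (machine_run t w).1 && ~~ isleaf (left (machine_run t w).2.1.2).

Definition bounded M n d (s : mstate) :=
  [/\ all (fun t => sz t <= M) s.1, size s.1 <= n & sz s.2 <= d].

Lemma sz_left t : sz (left t) <= sz t.
Proof. by case: t => // a b; rewrite sz_node /=; lia. Qed.

Lemma sz_right t : sz (right t) <= sz t.
Proof. by case: t => // a b; rewrite sz_node /=; lia. Qed.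

(** Pending instructions are subtrees of the code, so their sizes never grow. A step adds at most
    one of them, and a push adds at most its operand and one node to the store. This holds for
    meaningless code as well. *)
Lemma step_bounded M n d s : bounded M n d s -> bounded M n.+1 (d + M + 1) (step s).
Proof.
case: s => [[|i K] [[L c] R]]; rewrite /bounded /step /=.
  by move=> [_ _ szD]; split=> //; lia.
move=> [/andP [szi szK] szn szD].
have szl t : sz t <= M -> sz (left t) <= M by apply: leq_trans; exact: sz_left.
have szr t : sz t <= M -> sz (right t) <= M by apply: leq_trans; exact: sz_right.
have M1 : 0 < M by apply: leq_trans szi; exact: sz_gt0.
have szR : sz (head Leaf R) + sz (behead R) <= sz R + 1.
  by case: (R) => [|a R'] //=; rewrite sz_cons; lia.
have szL : sz (head Leaf L) + sz (behead L) <= sz L + 1.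
  by case: (L) => [|a L'] //=; rewrite sz_cons; lia.
have szc := sz_right c.
move: szD; rewrite !sz_pair => szD.
do ![case: ifP => _]; split; rewrite /= ?szK ?szi ?andbT ?szl ?szr //;
  rewrite ?sz_pair ?sz_cons ?sz_node ?sz_leaf; try lia.
all: by have := szr _ szi; lia.
Qed.

Lemma machine_bounded t w k (s := foldl (fun s _ => step s) (machine_init t w)
    (take k (spine (right (right t))))) :
  bounded (sz t) (sz t + 1) ((sz t + sz w + 10) + sz t * (sz t + 1)) s.
Proof.
have szt : size (take k (spine (right (right t)))) <= sz t.
  apply: (@leq_trans (size (spine (right (right t))))).
    by rewrite size_take; case: ltnP => // /ltnW.
  apply: leq_trans (ltnW (size_sz _)) _; rewrite /sz en_spine.
  by apply: leq_trans (sz_right _) (sz_right _).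
have h l n d s0 : bounded (sz t) n d s0 -> bounded (sz t) (n + size l)
    (d + size l * (sz t + 1)) (foldl (fun s (_ : tree) => step s) s0 l).
  elim: l n d s0 => [|x l IH] n d s0 hs /=; first by rewrite !addn0.
  have := IH _ _ _ (step_bounded hs).
  have -> : n.+1 + size l = n + (size l).+1 by lia.
  by have -> : d + sz t + 1 + size l * (sz t + 1) = d + (size l).+1 * (sz t + 1) by lia.
have [|h1 h2 h3] := h (take k (spine (right (right t)))) 1 (sz t + sz w + 10) (machine_init t w).
  rewrite /machine_init; split=> //=; first by rewrite sz_left.
  rewrite !sz_pair sz_cons !sz_nil; have h1 := sz_left (right t); have h2 := sz_right t.
  have -> : sz (en w) = sz w by []. lia.
split=> //; first by rewrite addnC; apply: leq_trans h2 _; lia.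
by apply: leq_trans h3 _; rewrite leq_add2l leq_mul2r szt orbT.
Qed.

Lemma sz_bounded M n d s : bounded M n d s -> sz s <= n * (M + 1) + d + 2.
Proof.
case: s => [K D] [/= hK hn hd]; rewrite sz_pair.
have : sz K <= size K * (M + 1) + 1.
  by elim: K hK {hn} => [|x K IH] //= /andP [hx /IH hK]; rewrite sz_cons; lia.
have : size K * (M + 1) <= n * (M + 1) by rewrite leq_mul2r hn orbT.
lia.
Qed.

Lemma fp_step T {eT : encodable T} (f : T -> mstate) : fp f -> fp (fun x => step (f x)).
Proof. by move=> hf; rewrite /step; fp_tac. Qed.

Section Machine.
Context {T : Type} {eT : encodable T}.

Lemma fp_machine_run (f : T -> tree) (g : T -> seq bool) :
  fp f -> fp g -> fp (fun x => machine_run (f x) (g x)).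
Proof.
move=> hf hg.
(* How much a step adds depends on the pending instructions in the accumulator, so [fp_foldl] does
   not apply and the invariant [bounded] supplies the size bound. *)
rewrite /machine_run; apply: (@fp_foldl_take _ _ tree _ _ _
  (fun x => spine (right (right (f x)))) (fun x => machine_init (f x) (g x)) (fun _ s _ => step s)).
- apply: (fp_conv (h := id) (f := fun x => right (right (f x)))) => // [x|].
    by rewrite en_spine.
  by fp_tac.
- by rewrite /machine_init; fp_tac.
- by apply: fp_step; fp_tac.
have pf : polyb (fun p : T * nat => sz p.1) (fun p => sz (f p.1)).
  by have [c hc] := fp_size hf; exists c => p.
have pg : polyb (fun p : T * nat => sz p.1) (fun p => sz (g p.1)).
  by have [c hc] := fp_size hg; exists c => p.
apply: (@poly_le _ _ _ (fun p => (sz (f p.1) + 1) * (sz (f p.1) + 1) +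
  ((sz (f p.1) + sz (g p.1) + 10) + sz (f p.1) * (sz (f p.1) + 1)) + 2)).
  by poly_tac.
by move=> p; apply: sz_bounded; exact: machine_bounded.
Qed.

Lemma fp_accept (f : T -> tree) (g : T -> seq bool) :
  fp f -> fp g -> fp (fun x => accept (f x) (g x)).
Proof. by move=> hf hg; have hr := fp_machine_run hf hg; rewrite /accept; fp_tac. Qed.

End Machine.

(** Surplus steps idle, so every sufficiently long clock [T] gives the answer of the program. *)
Lemma acceptP p x w t s b (T : tree) : exec no_oracle p (load [:: x; w]) t s -> s 0 = [:: b] ->
    slowdown p * t <= size (spine T) ->
  accept (Node (compile p) (Node (en x) T)) w = b.
Proof.
move=> e s0 le_T.
have z : zip_at 0 (load [:: x; w]) ([::], en x, [:: en w]).
  by split=> // -[|[|j]].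
have [[[L c] R] [/= _ ec _] [m le_m em]] := compileP e [::] z.
have runE : machine_run (Node (compile p) (Node (en x) T)) w = ([::], (L, c, R)).
  rewrite /machine_run /= /machine_init /=.
  have foldE (l : seq tree) u : foldl (fun s _ => step s) u l = iter (size l) step u.
    by elim: l u => //= y l IH u; rewrite IH -iterSr.
  rewrite foldE -(subnK (leq_trans le_m le_T)) iterD em.
  by elim: (_ - _) => //= k ->.
by rewrite /accept runE /= ec s0; case: b {s0}.
Qed.

(** * The network *)

(** Commutativity makes the iterated disjunction independent of the order of the neighbours, as a
    layer requires. *)
HB.instance Definition _ := Monoid.isComLaw.Build (seq bool) [::] orl orlA orlC or0l.

(* The absolute value of the numerator in binary, when there is one feature. *)
Definition numbits (raw : seq bool) := behead (head [::] (dec (head [::] (dec raw)))).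

Definition rowbits d (h : 'rV[rat]_d) :=
  numbits (enc_list [seq enc_rat (h ord0 j) | j <- enum 'I_d]).

(* Bit 0 of [z] comes from the centre of the star, bit 1 from the test node, and
   the last bit only marks the end of the witness, which is stored reversed. *)
Definition verdict (h z : seq bool) :=
  head false z && ~~ accept (parse_tree h) (behead (rev (behead (behead z)))).

Definition rcw_layer (i : nat) (h : 'rV[rat]_1) (s : seq 'rV[rat]_1) : 'rV[rat]_1 :=
  const_mx (verdict (rowbits h) (\big[orl/[::]]_(y <- s) rowbits y))%:R%R.

Lemma rcw_layer_perm i h s1 s2 : perm_eq s1 s2 -> rcw_layer i h s1 = rcw_layer i h s2.
Proof. by move=> e; rewrite /rcw_layer (perm_big _ e). Qed.

Definition rcw_gnn : gnn := @Gnn 1 (fun=> 1) 2 rcw_layer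
  (fun h => if h ord0 ord0 == 0%R then ord0 else ord_max) rcw_layer_perm.

Lemma val_infer n (X : 'I_n -> 'rV[rat]_1) (v : 'I_n) (G : graph 'I_n) :
  infer (g := rcw_gnn) X v G =
    verdict (rowbits (X v)) (\big[orl/[::]]_(w | adj G v w) rowbits (X w)) :> nat.
Proof.
rewrite /infer /= /rcw_layer mxE big_map big_filter big_enum_cond /=.
rewrite (eq_bigl (fun w => adj G v w)) //.
by case: (verdict _ _).
Qed.

Definition collect (row : seq bool) (fs : seq (seq bool)) :=
  (foldl (fun st f => (behead st.1, if head false st.1 then orl st.2 (numbits f) else st.2))
    (row, [::]) fs).2.

Lemma collectE (I : Type) (b : I -> bool) (F : I -> seq bool) (l : seq I) :
  collect [seq b i | i <- l] [seq F i | i <- l] = \big[orl/[::]]_(i <- l | b i) numbits (F i).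
Proof.
rewrite /collect; set f := fun _ _ => _.
suff h z : (foldl f ([seq b i | i <- l], z) [seq F i | i <- l]).2 =
    orl z (\big[orl/[::]]_(i <- l | b i) numbits (F i)) by rewrite h or0l.
elim: l z => [|x l IH] z; first by rewrite big_nil orlC.
by rewrite /= IH big_cons; case: (b x); rewrite // orlA.
Qed.

(** [[:: true]] and [[::]] are the numerals of the labels 1 and 0. *)
Definition label_bits (p : seq bool * seq bool * seq bool) : seq bool :=
  if verdict (numbits (sel (dec p.1.2) p.2)) (collect (sel (dec p.1.1) p.2) (dec p.1.2))
  then [:: true] else [::].

Lemma label_bitsP n (G : graph 'I_n) (X : 'I_n -> 'rV[rat]_1) (v : 'I_n) :
  label_bits (enc_rel (adj G), enc_feat X, enc_nat v) = enc_nat (infer (g := rcw_gnn) X v G).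
Proof.
rewrite val_infer /label_bits /enc_rel /enc_feat ![(_, _).1]/(fst _) ![(_, _).2]/(snd _) !decK !sel_nat.
rewrite !(nth_map v) -?enumT ?size_enum_ord // !nth_ord_enum collectE big_enum_cond /=.
rewrite (eq_bigl (fun w => adj G v w)) //.
by rewrite /rowbits; case: (verdict _ _).
Qed.

Lemma orl_cons x a y b : orl (x :: a) (y :: b) = (x || y) :: orl a b.
Proof.
apply: (@eq_from_nth _ false); first by rewrite /= !size_orl /= maxnSS.
by case=> [|i] _; rewrite nth_orl //= nth_orl.
Qed.

Lemma sz_orl a b : sz (orl a b) <= sz a + sz b.
Proof.
elim: a b => [|x a IH] [|y b].
- by [].
- by rewrite or0l leq_addl.
- by rewrite orlC or0l leq_addr.
rewrite orl_cons !sz_cons; have h := IH b.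
have : sz (x || y) <= sz x + sz y by case: x y => [] [].
lia.
Qed.

Lemma fp_numbits T {eT : encodable T} (f : T -> seq bool) :
  fp f -> fp (fun x => numbits (f x)).
Proof. by move=> hf; rewrite /numbits; fp_tac. Qed.

Lemma fp_collect T {eT : encodable T} (f : T -> seq bool) g :
  fp f -> fp g -> fp (fun x => collect (f x) (g x)).
Proof.
move=> hf hg; rewrite /collect; apply: fp_snd.
apply: (fp_foldl (b := fun p => sz (numbits p.2) + 10) (g := fun _ st f =>
  (behead st.1, if head false st.1 then orl st.2 (numbits f) else st.2))) => //.
- by fp_tac.
- by fp_tac; apply: fp_numbits; fp_tac.
- apply: poly_add; last exact: poly_const.
  by apply: (fp_size (f := fun p => numbits p.2)); apply: fp_numbits; fp_tac.
move=> x [c d] y /=; rewrite !sz_pair.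
have h1 : sz (behead c) <= sz c by exact: sz_behead.
by case: (head _ _); have := sz_orl d (numbits y); lia.
Qed.

Lemma fp_verdict T {eT : encodable T} (f g : T -> seq bool) :
  fp f -> fp g -> fp (fun x => verdict (f x) (g x)).
Proof.
by move=> hf hg; rewrite /verdict; fp_tac; apply: fp_accept; fp_tac.
Qed.

Lemma fp_label_bits : fp label_bits.
Proof.
rewrite /label_bits; apply: fp_if; try exact: fp_const.
apply: fp_verdict; first by apply: fp_numbits; fp_tac.
by apply: fp_collect; fp_tac.
Qed.

Lemma rcw_gnn_poly_time : poly_time_inference rcw_gnn.
Proof.
have [P [c hP]] := fp_run3 fp_label_bits.
exists (P 0), (2 * c + 3 ^ c) => n G X v _ _; rewrite -label_bitsP.
have [k le_k h] := hP (enc_rel (adj G)) (enc_feat X) (enc_nat v).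
by apply: runs_of_run h _; rewrite /= addn0 addnA.
Qed.

(** * Encodings *)

Lemma enc_list_inj : injective enc_list.
Proof. exact: can_inj decK. Qed.

(** [sel] decodes numerals: in a list whose items have pairwise different lengths, the selected item
    reveals the index. *)
Lemma enc_nat_inj : injective enc_nat.
Proof.
move=> m n e; pose s := mkseq (nseq^~ true) (m + n).+1.
have nths k : k <= m + n -> nth [::] s k = nseq k true by move=> h; rewrite nth_mkseq.
have := sel_nat s m; rewrite e sel_nat !nths ?leq_addr ?leq_addl // => /(congr1 size).
by rewrite !size_nseq.
Qed.

Lemma enc_rat_inj : injective enc_rat.
Proof.
move=> q r /enc_list_inj [eqs /enc_nat_inj eqn /enc_nat_inj eqd].
have en : numq q = numq r.
  by move: eqs eqn; case: (numq q) => a; case: (numq r) => b //= _; lia.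
have ed : denq q = denq r.
  by have := denq_gt0 q; have := denq_gt0 r; move: eqd; move: (denq q) (denq r) => a b; lia.
by rewrite -[q]divq_num_den -[r]divq_num_den en ed.
Qed.

Lemma enc_set_inj n : injective (@enc_set n).
Proof.
move=> A B /eq_in_map e; apply/setP => i.
by apply: e; rewrite mem_enum.
Qed.

Lemma enc_rel_inj n (e1 e2 : rel 'I_n) : enc_rel e1 = enc_rel e2 -> e1 = e2.
Proof.
move=> /enc_list_inj /eq_in_map e; apply: functional_extensionality => i.
apply: functional_extensionality => j.
have /eq_in_map := e i (mem_enum _ i); apply; exact: mem_enum.
Qed.

Lemma enc_rel_size n n' (e1 : rel 'I_n) (e2 : rel 'I_n') : enc_rel e1 = enc_rel e2 -> n = n'.
Proof. by move=> /enc_list_inj /(congr1 size); rewrite !size_map -!enumT !size_enum_ord. Qed.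

Lemma enc_feat_inj n d : injective (@enc_feat n d).
Proof.
move=> X Y /enc_list_inj /eq_in_map e; apply: functional_extensionality => i.
apply/rowP => j; have /enc_list_inj/eq_in_map := e i (mem_enum _ i).
by move=> /(_ j (mem_enum _ j)) /enc_rat_inj.
Qed.

(** [rcw_verification] accepts a string as soon as some configuration with this code is robust, so
    the code must determine the configuration. The node set of the graph is not written down, hence
    the two hypotheses. *)
Lemma enc_config_inj d (C C' : config d) :
    nodes (input_graph C) = setT -> nodes (input_graph C') = setT ->
  enc_config C = enc_config C' -> C = C'.
Proof.
case: C => n [N e] X [N1 e1] S k; case: C' => n' [N' e'] X' [N1' e1'] S' k' /= eN eN'.
move=> /enc_list_inj [e_adj]; have en := enc_rel_size e_adj.
case: n' / en N' e' X' N1' e1' S' eN' e_adj => N' e' X' N1' e1' S' eN'.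
by move=> /enc_rel_inj -> /enc_feat_inj -> /enc_set_inj -> /enc_rel_inj -> /enc_set_inj ->
  /enc_nat_inj ->; rewrite eN eN'.
Qed.

Fixpoint pos_of (s : seq bool) : positive :=
  if s is b :: s' then
    if nilp s' then xH else (if b then xI else xO) (pos_of s')
  else xH.

Definition num_of s := Pos.to_nat (pos_of s).

Lemma num_ofK s : last false s -> enc_nat (num_of s) = s.
Proof.
rewrite /enc_nat; have -> : N.of_nat (num_of s) = Npos (pos_of s) by exact: (N2Nat.id (Npos _)).
by elim: s => //= -[] [|b s] //= IH /IH ->.
Qed.

Lemma num_of_pow n : num_of (rcons (nseq n false) true) = 2 ^ n.
Proof.
elim: n => // n IH; rewrite expnS -IH /num_of /=.
by case: n {IH} => [|n] //=; rewrite Pos2Nat.inj_xO; lia.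
Qed.

Lemma enum_ord1 : enum 'I_1 = [:: ord0].
Proof. by apply: (inj_map val_inj); rewrite val_enum_ord. Qed.

Lemma enc_rat_num s : last false s ->
  enc_rat (num_of s)%:R%R = enc_list [:: false :: s; [:: true]].
Proof.
move=> hs; rewrite /enc_rat -[(num_of s)%:R%R]/((Posz (num_of s))%:~R)%R numq_int denq_int.
by rewrite absz_nat num_ofK.
Qed.

Definition feature (s : seq bool) : 'rV[rat]_1 := const_mx (num_of s)%:R%R.

Lemma rowbits_feature s : last false s -> rowbits (feature s) = s.
Proof.
by move=> hs; rewrite /rowbits enum_ord1 /= mxE enc_rat_num // /numbits !decK.
Qed.

(** * The reduction *)

Definition node_bits (h : seq bool) (i : nat) :=
  if i == 1 then h else rcons (nseq i false) true.

Section Config.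
Variables (m : nat) (h : seq bool).
Hypothesis last_h : last false h.

Definition test_node : 'I_m.+2 := Ordinal (isT : 1 < m.+2).

Definition star : graph 'I_m.+2 := Graph setT (fun i j : 'I_m.+2 => (i == 0 :> nat) (+) (j == 0 :> nat)).

Definition spoke : graph 'I_m.+2 := Graph [set i : 'I_m.+2 | i < 2] (fun i j : 'I_m.+2 => i + j == 1).

(** The budget exceeds the number of nodes, so it allows every choice of neighbours of the test
    node. A power of two has a numeral that is easily written from a unary [m]. *)
Definition star_config : config 1 :=
  Config star (fun i : 'I_m.+2 => feature (node_bits h i)) spoke [set test_node] (2 ^ m.+2).

Lemma star_config_valid : valid_config star_config.
Proof.
have star0 (x : 'I_m.+2) : connect (adj star) x ord0.
  have [->|x0] := eqVneq x ord0; first exact: connect0.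
  by apply: connect1; rewrite /= (negPf (x0 : (x : nat) != 0)).
have starC : symmetric (adj star) by move=> x y; rewrite /= addbC.
split=> //.
- by split=> // [x|x y _]; rewrite /= ?addbb ?inE.
- split=> [|x y _ _]; first by apply/set0Pn; exists ord0; rewrite inE.
  apply: connect_trans (star0 x) _; rewrite (sym_connect_sym starC); exact: star0.
- split=> /=; last 2 first.
  + exact: subsetT.
  + by move=> x y /=; case: (val x) (val y) => [|[|a]] [|[|b]].
  split=> [x y|x|x y] /=; first by rewrite addnC.
    by rewrite addnn; case: (val x) => [|[]].
  by rewrite !inE => /eqP; case: (val x) (val y) => [|[|a]] [|[|b]].
Qed.

Let bits (i : 'I_m.+2) := node_bits h i.

Lemma infer_star v (G : graph 'I_m.+2) :
  infer (g := rcw_gnn) (features star_config) v G =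
    verdict (bits v) (\big[orl/[::]]_(w | adj G v w) bits w) :> nat.
Proof.
rewrite val_infer rowbits_feature; last first.
  by rewrite /node_bits; case: eqP => // _; rewrite last_rcons.
congr (nat_of_bool (verdict _ _)); apply: eq_bigr => w _.
by rewrite rowbits_feature // /node_bits; case: eqP => // _; rewrite last_rcons.
Qed.

Lemma nth_bits (w : 'I_m.+2) j : w != test_node -> nth false (bits w) j = (j == w).
Proof.
rewrite /bits /node_bits -val_eqE /= => /negPf ->; rewrite nth_rcons size_nseq.
by case: ltngtP => //; rewrite nth_nseq => ->.
Qed.

(** The test node is excluded because its string [h] is arbitrary; any other node contributes a
    single bit at its own position. *)
Lemma nth_bigor (P : pred 'I_m.+2) j : ~~ P test_node ->
  nth false (\big[orl/[::]]_(w | P w) bits w) j = [exists w, P w && (j == w)].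
Proof.
move=> Pt; transitivity (\big[orb/false]_(w | P w) (j == w)); last by rewrite big_orE.
apply: (big_ind2 (fun s b => nth false s j = b)) => [|x1 x2 y1 y2 <- <-|w Pw].
- by rewrite nth_nil.
- exact: nth_orl.
- by apply: nth_bits; apply: contraNneq Pt => <-.
Qed.

Lemma size_bigor (P : pred 'I_m.+2) k : ~~ P test_node -> (forall w : 'I_m.+2, P w -> w < k) ->
  size (\big[orl/[::]]_(w | P w) bits w) <= k.
Proof.
move=> Pt hP; apply: (big_ind (fun s : seq bool => size s <= k)) => // [a b|w Pw].
  by rewrite size_orl geq_max => -> ->.
have : w != test_node by apply: contraNneq Pt => <-.
rewrite /bits /node_bits -val_eqE /= => /negPf ->; rewrite size_rcons size_nseq.
exact: hP.
Qed.

(** The neighbours are the positions of ones in [z]. The lengths agree because [z] ends with a one,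
    contributed by the largest neighbour. *)
Lemma bigor_eq (P : pred 'I_m.+2) z : ~~ P test_node -> last false z -> size z <= m.+2 ->
  (forall w : 'I_m.+2, P w = nth false z w) -> \big[orl/[::]]_(w | P w) bits w = z.
Proof.
move=> Pt zl sz hP; set y := \big[_/_]_(w | _) _.
have nthy j : nth false y j = nth false z j.
  rewrite nth_bigor //; case: (ltnP j (size z)) => hj; last first.
    rewrite nth_default //; apply/existsP => -[w /andP [Pw /eqP jw]].
    by move: Pw; rewrite hP -jw nth_default.
  apply/existsP/idP => [[w /andP [Pw /eqP ->]]|zj]; first by rewrite -hP.
  by exists (Ordinal (leq_trans hj sz)); rewrite hP zj eqxx.
have szy : size y = size z.
  apply/eqP; rewrite eqn_leq; apply/andP; split.
    apply: size_bigor => // w; rewrite hP; apply: contraTT; rewrite -leqNgt => ?.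
    by rewrite nth_default.
  case: z zl nthy {sz hP} => // b z zl nthy.
  rewrite leqNgt; apply/negP => lt_y; move: (nthy (size z)).
  by rewrite nth_default // [nth _ _ _](nth_last false (b :: z)) zl.
by apply: (@eq_from_nth _ false).
Qed.

Lemma infer_unprotected (G : graph 'I_m.+2) :
    ~~ adj G test_node ord0 -> ~~ adj G test_node test_node ->
  infer (g := rcw_gnn) (features star_config) test_node G = 0 :> nat.
Proof.
move=> G0 Gt; rewrite infer_star /verdict -nth0 nth_bigor //.
case: existsP => // -[w /andP [Gw /eqP w0]].
by move: Gw; have -> : w = ord0 by [apply: val_inj]; rewrite (negPf G0).
Qed.

(** Of the [m + 2] positions two go to the centre and the test node and one to the end marker, which
    leaves fewer than [m] for the witness. *)
Definition rejecting := forall w, size w < m -> ~~ accept (parse_tree h) w.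

Lemma infer_protected (G : graph 'I_m.+2) : rejecting -> 0 < m ->
    adj G test_node ord0 -> ~~ adj G test_node test_node ->
  infer (g := rcw_gnn) (features star_config) test_node G = 1 :> nat.
Proof.
move=> rej m0 G0 Gt; rewrite infer_star /verdict -nth0 nth_bigor //.
have -> : [exists w, adj G test_node w && (0 == w :> nat)].
  by apply/existsP; exists ord0; rewrite G0.
rewrite rej //; set z := \big[_/_]_(_ | _) _.
have : size z <= m.+2 by apply: size_bigor.
(* If [z] is too short to carry a witness, the empty string is read, and [0 < m] puts it in
   range. *)
by rewrite size_behead size_rev !size_behead; lia.
Qed.

Lemma infer_accepted (G : graph 'I_m.+2) w : accept (parse_tree h) w -> size w < m ->
    ~~ adj G test_node test_node ->
    (forall i : 'I_m.+2, adj G test_node i = nth false (rcons [:: true, false & rev w] true) i) ->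
  infer (g := rcw_gnn) (features star_config) test_node G = 0 :> nat.
Proof.
move=> acc szw Gt hG; rewrite infer_star (bigor_eq (z := rcons [:: true, false & rev w] true)) //.
- rewrite /verdict /= rev_rcons revK /=.
  by rewrite /bits /node_bits /= acc.
- by rewrite last_rcons.
- by rewrite size_rcons /= size_rev.
Qed.

Lemma star_config_robust : 0 < m ->
  robust_counterfactual (g := rcw_gnn) (features star_config) (2 ^ m.+2) test_node star spoke
    <-> rejecting.
Proof.
move=> m0; have t0 : test_node != ord0 by [].
have adj_t (F : {set {set 'I_m.+2}}) : disturbance (2 ^ m.+2) star spoke F ->
    ~~ adj (flip star F) test_node test_node /\ adj (flip star F) test_node ord0.
  move=> [_ hF]; split=> /=.
    apply/negP => /hF [x [y [_ _ xy e _]]].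
    have : x \in [set test_node; test_node] by rewrite e !inE eqxx.
    have : y \in [set test_node; test_node] by rewrite e !inE eqxx orbT.
    by rewrite !inE !orbb => /eqP ey /eqP ex; rewrite ex ey eqxx in xy.
  apply/negP => /hF [x [y [_ _ xy e]]].
  have : x \in [set test_node; ord0] by rewrite e !inE eqxx.
  have : y \in [set test_node; ord0] by rewrite e !inE eqxx orbT.
  by rewrite !inE => /orP [] /eqP ey /orP [] /eqP ex; move: xy; rewrite ex ey ?eqxx.
have rm0 F : ~~ adj (remove_edges (flip star F) spoke) test_node ord0 by rewrite /= andbF.
have rmt F : ~~ adj (flip star F) test_node test_node ->
    ~~ adj (remove_edges (flip star F) spoke) test_node test_node.
  by apply: contra => /andP [].
have dist0 : disturbance (2 ^ m.+2) star spoke set0.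
  by split=> [|e]; rewrite ?cards0 ?inE.
have flip0 : adj (flip star set0) = adj star.
  apply: functional_extensionality => i; apply: functional_extensionality => j.
  by rewrite /= inE addbF.
have infer0 : infer (g := rcw_gnn) (features star_config) test_node (flip star set0) =
    infer (g := rcw_gnn) (features star_config) test_node star by rewrite /infer flip0.
(* Neither graph consists of the test node alone, so the convention for single nodes never decides a
   label. *)
have nodesT : ([set: 'I_m.+2] == [set test_node]) = false.
  apply/negbTE/eqP => /setP /(_ ord0); rewrite !inE => /esym/eqP e.
  by rewrite e eqxx in t0.
have nodesH : (nodes spoke == [set test_node]) = false.
  apply/negbTE/eqP => /setP /(_ ord0); rewrite !inE => /esym/eqP e.
  by rewrite e eqxx in t0.
have lbl0 F : label_on (g := rcw_gnn) (features star_config)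
    (infer (g := rcw_gnn) (features star_config) test_node star)
    test_node (remove_edges (flip star F) spoke) =
    Some (infer (g := rcw_gnn) (features star_config) test_node (remove_edges (flip star F) spoke)).
  by rewrite /label_on /= inE nodesT.
split=> [rob w szw|rej F dF].
  apply/negP => acc.
  pose z := rcons [:: true, false & rev w] true.
  (* In the star the test node is adjacent to the centre only. Flipping its pairs with the other
     ones of [z] makes its neighbours spell [z]; bit 0 is already present, and bit 1 is zero, so no
     loop arises. *)
  pose S := [set i : 'I_m.+2 | nth false z i & i != ord0].
  pose F := [set [set test_node; i] | i in S].
  have St : test_node \notin S by rewrite inE.
  have dF : disturbance (2 ^ m.+2) star spoke F.
    split=> [|e /imsetP [i iS ->]].
      apply: leq_trans (leq_imset_card _ _) _; apply: leq_trans (max_card _) _.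
      by rewrite card_ord ltnW // ltn_expl.
    exists test_node, i; split; rewrite ?inE //.
      by apply: contraNneq St => ->.
    by move: iS; rewrite !inE -val_eqE /= => /andP [_]; case: (val i).
  have [Ft F0] := adj_t F dF.
  have inF (i : 'I_m.+2) : ([set test_node; i] \in F) = (i \in S).
    apply/imsetP/idP => [[j jS /setP e]|iS]; last by exists i.
    have : j \in [set test_node; i] by rewrite e !inE eqxx orbT.
    rewrite in_set2 => /orP [/eqP jt|/eqP <- //].
    by rewrite jt (negPf St) in jS.
  (* The disturbed graph has label 0 with the spoke, by acceptance, and without it, so the removal
     changes nothing. *)
  have [e1 [_ ne]] := rob F dF; apply: ne; rewrite lbl0; congr Some; rewrite -e1; apply: ord_inj.
  rewrite (infer_unprotected (rm0 _) (rmt _ Ft)) (infer_accepted acc szw Ft) // => i.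
  by rewrite [LHS]/= inF inE -val_eqE /=; case: (val i) => [|[|k]] //; rewrite andbT.
have [Ft F0] := adj_t F dF; have [t00 t0t] := adj_t _ dist0.
have star1 : infer (g := rcw_gnn) (features star_config) test_node star = 1 :> nat.
  by rewrite -infer0 infer_protected.
split; first by apply: ord_inj; rewrite infer_protected // star1.
split.
  rewrite /factual /label_on nodesH (_ : (test_node \notin nodes spoke) = false); last by rewrite inE.
  (* [adj spoke test_node] and [adj star test_node] are convertible. *)
  exact: erefl.
by rewrite lbl0 => -[] /(congr1 (@nat_of_ord 2)); rewrite star1 (infer_unprotected (rm0 _) (rmt _ Ft)).
Qed.

End Config.

(** * Writing the instance in polynomial time *)

Definition item (s : seq bool) := foldl (fun a b => true :: b :: a) [:: false] (rev s).

Lemma enc_list_cons s ss : enc_list (s :: ss) = item s ++ enc_list ss.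
Proof.
rewrite /enc_list /=; congr (_ ++ _); rewrite /item foldl_rev.
by elim: s => //= b s <-.
Qed.

Lemma enc_list_nil : enc_list [::] = [::].
Proof. by []. Qed.

Definition fill b (u : seq bool) : seq bool := foldl (fun a _ => b :: a) [::] u.

Lemma fillE b u : fill b u = nseq (size u) b.
Proof.
rewrite /fill -[RHS]cats0; elim: u [::] => //= _ u IH a; rewrite IH.
by elim: (size u) => //= k ->.
Qed.

Definition rep (s u : seq bool) := foldl (fun a _ => s ++ a) [::] u.

Lemma repE s u : rep s u = flatten (nseq (size u) s).
Proof.
rewrite /rep -[RHS]cats0; elim: u [::] => //= _ u IH a; rewrite IH -catA.
by elim: (size u) => //= k IHk; rewrite -!catA IHk.
Qed.

(** Numbers are kept in unary, as lengths of strings. The exponent is fixed in advance, so a power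
    is a fixed number of nested folds. *)
Fixpoint upow (u : seq bool) d := if d is d'.+1 then rep (upow u d') u else [:: true].

Lemma size_rep s u : size (rep s u) = size u * size s.
Proof. by rewrite repE size_flatten /shape map_nseq sumn_nseq mulnC. Qed.

Lemma size_upow u d : size (upow u d) = size u ^ d.
Proof. by elim: d => //= d IH; rewrite size_rep IH expnS. Qed.

Section Fp.
Context {T U : Type} {eT : encodable T} {eU : encodable U}.

Lemma fp_item (f : T -> seq bool) : fp f -> fp (fun x => item (f x)).
Proof.
move=> hf; apply: (fp_foldl (b := fun _ => 10) (g := fun _ a b => true :: b :: a)) => //.
- by fp_tac.
- exact: fp_const.
- by fp_tac.
- exact: poly_const.
by move=> x a y; rewrite !sz_cons sz_true; have := sz_bool y; lia.
Qed.

Lemma fp_fill b (f : T -> seq bool) : fp f -> fp (fun x => fill b (f x)).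
Proof.
move=> hf; apply: (fp_foldl (b := fun _ => 10) (g := fun _ a _ => b :: a)) => //.
- exact: fp_const.
- by fp_tac.
- exact: poly_const.
by move=> x a y; rewrite !sz_cons; have := sz_bool b; lia.
Qed.

Lemma fp_rep (f g : T -> seq bool) : fp f -> fp g -> fp (fun x => rep (f x) (g x)).
Proof.
move=> hf hg; apply: (fp_foldl (b := fun p => sz (f p.1)) (g := fun x a _ => f x ++ a)) => //.
- exact: fp_const.
- by fp_tac; apply: (fp_comp (f := fun p => p.1.1) _ hf); fp_tac.
- by apply: (fp_size (f := fun p => f p.1)); apply: (fp_comp (f := fst) _ hf); fp_tac.
move=> x a y /=; have h : sz (f x ++ a) + 1 = sz (f x) + sz a by exact: sz_cat.
by lia.
Qed.

Lemma fp_en (f : T -> U) : fp f -> fp (fun x => en (f x)).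
Proof. by apply: (@fp_conv _ _ _ _ T tree _ _ id f). Qed.

End Fp.

Lemma fp_upow T {eT : encodable T} (f : T -> seq bool) d :
  fp f -> fp (fun x => upow (f x) d).
Proof.
by move=> hf; elim: d => [|d IH] /=; [exact: fp_const | exact: fp_rep].
Qed.

Ltac fp_more ::= match goal with
  | |- fp (fun x => @?f x ++ @?g x) => apply: (fp_cat (f := f) (g := g))
  | |- fp (fun x => rev (@?f x)) => apply: (fp_rev (f := f))
  | |- fp (fun x => item (@?f x)) => apply: (fp_item (f := f))
  | |- fp (fun x => fill _ (@?f x)) => apply: (fp_fill _ (f := f))
  | |- fp (fun x => rep (@?f x) (@?g x)) => apply: (fp_rep (f := f) (g := g))
  | |- fp (fun x => upow (@?f x) _) => apply: (fp_upow _ (f := f))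
  | |- fp (fun x => en (@?f x)) => apply: (fp_en (f := f))
  end.

(** From the inside: sign bit 0 with the numerator, then the denominator 1; this rational is the
    only coordinate, and the vector is one entry of the list of features. *)
Definition enc_feature (s : seq bool) := item (item (item (false :: s) ++ item [:: true])).

(** The features from node 2 on: the state carries the zeros of the current power of two, hence the
    two initial zeros. *)
Definition enc_features (u : seq bool) :=
  (foldl (fun st _ => (false :: st.1, st.2 ++ enc_feature (st.1 ++ [:: true])))
     ([:: false; false], [::]) u).2.

Lemma fp_enc_features T {eT : encodable T} (f : T -> seq bool) :
  fp f -> fp (fun x => enc_features (f x)).
Proof.
move=> hf; rewrite /enc_features; apply: fp_snd.
pose F := fun st (_ : bool) =>
  (false :: st.1, st.2 ++ enc_feature (st.1 ++ [:: true])) : seq bool * seq bool.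
have [c hc] : polyb sz (fun s : seq bool => sz (enc_feature (s ++ [:: true]))).
  by apply: (fp_size (f := fun s => enc_feature (s ++ [:: true]))); rewrite /enc_feature; fp_tac.
(* Each feature is longer than the previous one, so the growth depends on the accumulator and needs
   an explicit bound. *)
apply: (@fp_foldl_take _ _ _ _ _ _ f (fun _ => ([:: false; false], [::])) (fun _ => F)) => //.
- exact: fp_const.
- by rewrite /F /enc_feature; fp_tac.
have sz_nseq k : sz (nseq k false) = 2 * k + 1.
  by elim: k => //= k IH; rewrite sz_cons IH sz_false; lia.
have bound l k a : sz (foldl F (nseq k false, a) l) <=
    2 * (k + size l) + sz a + size l * (2 * (k + size l) + 3) ^ c + 2.
  elim: l k a => [|y l IH] k a /=; first by rewrite sz_pair sz_nseq; lia.
  apply: leq_trans (IH k.+1 (a ++ enc_feature (nseq k false ++ [:: true]))) _.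
  have h1 := hc (nseq k false).
  have h2 : sz (a ++ enc_feature (nseq k false ++ [:: true])) + 1 =
    sz a + sz (enc_feature (nseq k false ++ [:: true])) by exact: sz_cat.
  rewrite sz_nseq in h1; rewrite addSnnS.
  have h3 : (2 * k + 1).+2 ^ c <= (2 * (k + (size l).+1) + 3) ^ c.
    by case: (c) => // e; rewrite leq_exp2r //; lia.
  by move: h1 h2 h3; rewrite mulSn; lia.
have [e he] := fp_size hf.
apply: (@poly_le _ _ _ (fun p => 2 * (2 + sz (f p.1)) + 1 +
    sz (f p.1) * (2 * (2 + sz (f p.1)) + 3) ^ c + 2)); last first.
  move=> [x k] /=; have szk : size (take k (f x)) <= sz (f x).
    by apply: leq_trans (ltnW (size_sz _)); rewrite size_take; case: ltnP => // /ltnW.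
  apply: leq_trans (bound (take k (f x)) 2 [::]) _.
  have : size (take k (f x)) * (2 * (2 + size (take k (f x))) + 3) ^ c <=
      sz (f x) * (2 * (2 + sz (f x)) + 3) ^ c.
    by apply: leq_mul => //; case: (c) => // j; rewrite leq_exp2r //; lia.
  by rewrite sz_nil; lia.
have pf : polyb (fun p : T * nat => sz p.1) (fun p => sz (f p.1)) by exists e => p.
by poly_tac.
Qed.

Lemma enum_iota n A (f : nat -> A) : [seq f (val i) | i <- enum 'I_n] = mkseq f n.
Proof. by rewrite /mkseq -val_enum_ord -map_comp. Qed.

(** In the star, the spoke and the node sets only the indices 0 and 1 are special, so every row is
    two bits followed by a constant. *)
Lemma mkseq2 A (f : nat -> A) c m : (forall i, f i.+2 = c) ->
  mkseq f m.+2 = [:: f 0, f 1 & nseq m c].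
Proof.
move=> hf; rewrite /mkseq /=; congr [:: _, _ & _].
have h k : [seq f i | i <- iota k.+2 m] = nseq m c; last exact: (h 0).
by elim: m k => //= m IH k; rewrite hf IH.
Qed.

Lemma enc_rel_rows m (F : nat -> nat -> bool) c : (forall i, mkseq (F i.+2) m.+2 = c) ->
  enc_rel (fun i j : 'I_m.+2 => F i j) =
    enc_list [:: mkseq (F 0) m.+2, mkseq (F 1) m.+2 & nseq m c].
Proof.
move=> hc; rewrite /enc_rel; congr enc_list.
rewrite -(mkseq2 (f := fun i => mkseq (F i) m.+2) m hc) -enum_iota.
by apply: eq_map => i; rewrite enum_iota.
Qed.

Lemma enc_list_nseq s u : enc_list (nseq (size u) s) = rep (item s) u.
Proof. by rewrite repE; elim: u => //= _ u <-; rewrite enc_list_cons. Qed.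

Lemma enc_set_val m (P : pred nat) : (forall i, P i.+2 = false) ->
  enc_set [set i : 'I_m.+2 | P i] = [:: P 0, P 1 & nseq m false].
Proof.
move=> hP; rewrite -(mkseq2 m hP) -enum_iota /enc_set.
by apply: eq_map => i; rewrite inE.
Qed.

Definition enc_star (u : seq bool) :=
  item [:: false, true & fill true u] ++ item [:: true, false & fill false u] ++
  rep (item [:: true, false & fill false u]) u.

Definition enc_spoke (u : seq bool) :=
  item [:: false, true & fill false u] ++ item [:: true, false & fill false u] ++
  rep (item [:: false, false & fill false u]) u.

Definition enc_star_config (h u : seq bool) :=
  item (enc_star u) ++ item (enc_feature [:: true] ++ enc_feature h ++ enc_features u) ++
  item [:: true, true & fill false u] ++ item (enc_spoke u) ++
  item [:: false, true & fill false u] ++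
  item (false :: false :: fill false u ++ [:: true]).

Lemma enc_features_loop k (u a : seq bool) : (foldl (fun st _ => (false :: st.1, st.2 ++ enc_feature (st.1 ++ [:: true])))
     (nseq k false, a) u).2 =
  a ++ flatten [seq enc_feature (rcons (nseq i false) true) | i <- iota k (size u)] :> seq bool.
Proof.
elim: u k a => [|b u IH] k a /=; first by rewrite cats0.
by rewrite (IH k.+1) -catA cats1.
Qed.

Lemma enc_config_star h u : last false h ->
  enc_config (star_config (size u) h) = enc_star_config h u.
Proof.
move=> hl; rewrite /enc_config !enc_list_cons enc_list_nil cats0.
rewrite /enc_star_config.
congr (item _ ++ (item _ ++ (item _ ++ (item _ ++ (item _ ++ item _))))).
- rewrite /= (@enc_rel_rows _ (fun i j => (i == 0) (+) (j == 0)) [:: true, false & nseq (size u) false]).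
    rewrite (@mkseq2 _ _ true _ (fun=> erefl)) (@mkseq2 _ _ false _ (fun=> erefl)).
    by rewrite !enc_list_cons enc_list_nseq /enc_star !fillE.
  by move=> i; exact: (@mkseq2 _ _ false _ (fun=> erefl)).
- rewrite /enc_feat /=.
  have -> : [seq enc_list [seq enc_rat (feature (node_bits h (val i)) ord0 j) | j <- enum 'I_1]
      | i <- enum 'I_(size u).+2] =
    mkseq (fun i => enc_list [:: enc_list [:: false :: node_bits h i; [:: true]]]) (size u).+2.
    rewrite -enum_iota; apply: eq_map => i; rewrite enum_ord1 /= mxE enc_rat_num //.
    by rewrite /node_bits; case: eqP => // _; rewrite last_rcons.
  rewrite /enc_features -[[:: false; false]]/(nseq 2 false) enc_features_loop cat0s.
  rewrite /mkseq [iota _ _]/= [map _ _]/= !enc_list_cons !enc_list_nil !cats0.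
  congr (_ ++ (_ ++ _)).
  have : all (leq 2) (iota 2 (size u)) by apply/allP => i; rewrite mem_iota => /andP [].
  elim: (iota _ _) => //= i s IH /andP [i2 /IH {}IH].
  rewrite !enc_list_cons enc_list_nil !cats0 -IH /node_bits.
  by case: i i2 => [|[]].
- by rewrite /= (@enc_set_val _ (fun i => i < 2)) // fillE.
- rewrite /= (@enc_rel_rows _ (fun i j => i + j == 1) [:: false, false & nseq (size u) false]).
    rewrite !(@mkseq2 _ _ false _ (fun=> erefl)).
    by rewrite !enc_list_cons enc_list_nseq /enc_spoke !fillE.
  by move=> i; exact: (@mkseq2 _ _ false _ (fun=> erefl)).
- have -> : test_nodes (star_config (size u) h) = [set i : 'I_(size u).+2 | val i == 1].
    by apply/setP => i; rewrite !inE -val_eqE.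
  by rewrite /= (@enc_set_val _ (fun i => i == 1)) // fillE.
- by rewrite /= -num_of_pow num_ofK ?last_rcons //= fillE cats1.
Qed.

Lemma rcw_verification_star u h : 0 < size u -> last false h ->
  rcw_verification rcw_gnn (enc_star_config h u) <-> rejecting (size u) h.
Proof.
move=> u0 hl; rewrite -enc_config_star // -star_config_robust //; split.
  move=> [C [eC [_ nC _ _] rob]].
  have := enc_config_inj (erefl : nodes (input_graph (star_config (size u) h)) = setT) nC eC.
  by move=> eC'; rewrite -eC' in rob; apply: rob; rewrite inE.
move=> rob; exists (star_config (size u) h); split=> //; first exact: star_config_valid.
by move=> v; rewrite inE => /eqP ->.
Qed.

(** * The instance for a language in NP and its oracle query *)

Section Reduction.
Variables (p : prog) (c d : nat).

(* One node for every bit of a longest witness, and one for the end marker. *)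
Definition room (x : seq bool) := true :: upow x d ++ nseq d true.

(** Its length is the time bound of the verifier on [x] and any witness that fits into [room x],
    times the overhead of the machine. *)
Definition clock (x : seq bool) :=
  rep (upow (x ++ room x) c ++ nseq c true) (nseq (slowdown p) true).

Definition instance_bits (x : seq bool) :=
  rev (pre (Node (compile p) (Node (en x) (en (clock x))))).

Lemma size_room x : size (room x) = (size x ^ d + d).+1.
Proof. by rewrite /= size_cat size_upow size_nseq. Qed.

Lemma fp_reduction : fp (fun x => enc_star_config (instance_bits x) (room x)).
Proof.
have hr : fp room by rewrite /room; fp_tac.
have hc : fp clock by rewrite /clock; fp_tac.
have hi : fp instance_bits.
  apply: fp_rev; apply: (fp_comp (g := fun t : tree => pre t) _ (@fp_quote0 tree _)).
  by fp_tac.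
rewrite /enc_star_config /enc_star /enc_spoke /enc_feature.
have hf := fp_enc_features hr.
by fp_tac.
Qed.

Variable V : seq bool -> seq bool -> bool.
Hypothesis runV : forall x w, runs no_oracle p c [:: x; w] [:: V x w].

Lemma accept_instance x w : size w <= size x ^ d + d ->
  accept (parse_tree (instance_bits x)) w = V x w.
Proof.
move=> szw; rewrite /instance_bits parse_treeK.
have [t [s [e le_t s0]]] := runV x w; apply: (acceptP e s0).
have -> : size (spine (en (clock x))) = size (clock x) by elim: (clock x) => //= b l ->.
rewrite size_rep size_nseq leq_mul2l size_cat size_upow size_cat size_room size_nseq.
apply/orP; right; apply: leq_trans le_t _; rewrite leq_add2r.
by case: (c) => // k; rewrite leq_exp2r //=; lia.
Qed.

Lemma rejecting_instance x :
  rejecting (size (room x)) (instance_bits x) <->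
  ~ exists w, size w <= size x ^ d + d /\ V x w.
Proof.
rewrite /rejecting size_room; split=> [rej [w [szw Vw]]|no w szw].
  by have := rej w szw; rewrite accept_instance // Vw.
by rewrite accept_instance //; apply/negP => Vw; apply: no; exists w.
Qed.

End Reduction.

Lemma rcw_np_hard : np_hard (rcw_verification rcw_gnn).
Proof.
move=> A [V [p [c [d [runV AP]]]]].
have [P [e hP]] := fp_run1 (fp_reduction p c d).
(* The oracle says yes when there is no witness, so its answer is negated. *)
pose answer := Case 0 (Seq (Pop 0) (Push 0 false)) (Seq (Pop 0) (Push 0 true)) Skip.
(* Three additional factors of a base that is at least 2 cover the four steps of the query and of
   [answer]. *)
exists (Seq (P 0) (Seq (Query 0) answer)), (2 * e.+3 + 3 ^ e.+3) => x.
pose q := enc_star_config (instance_bits p c d x) (room d x).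
have Aq : A x <-> ~ rcw_verification rcw_gnn q.
  rewrite /q rcw_verification_star; last 2 first.
  - by rewrite size_room.
  - by rewrite /instance_bits /= rev_cons last_rcons.
  rewrite (rejecting_instance d runV) AP; split=> [Vx no|/NNPP //]; exact: no.
have [n le_n hn] := hP x; have [k le_k ek] := hn (rcw_verification rcw_gnn) (fun=> [::]) 0.
rewrite !frame0 -/q in ek.
have le_t : k + (1 + (1 + 1).+1) <= sumn (map size [:: x]) ^ (2 * e.+3 + 3 ^ e.+3) +
    (2 * e.+3 + 3 ^ e.+3).
  rewrite /= addn0; apply: leq_trans (poly_runs _ _); rewrite !expnS.
  have : 0 < (size x).+2 ^ e by rewrite expn_gt0.
  by have := leq_trans le_k le_n; move: (_ ^ e) => z; nia.
(* The run depends on the oracle's answer, and membership in the oracle is an arbitrary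
   proposition. *)
have [qB|qB] := classic (rcw_verification rcw_gnn q).
  exists false; split; first by split=> // /Aq.
  exists (k + (1 + (1 + 1).+1)), (upd (upd (upd (load [:: q]) 0 [:: true]) 0 [::]) 0 [:: false]).
  split=> //; apply: ExecSeq ek _; apply: ExecSeq; first exact: ExecQueryYes.
  by apply: ExecCase; apply: ExecSeq; [exact: ExecPop | exact: ExecPush].
exists true; split; first by split=> // _; apply/Aq.
exists (k + (1 + (1 + 1).+1)), (upd (upd (upd (load [:: q]) 0 [:: false]) 0 [::]) 0 [:: true]).
split=> //; apply: ExecSeq ek _; apply: ExecSeq; first exact: ExecQueryNo.
by apply: ExecCase; apply: ExecSeq; [exact: ExecPop | exact: ExecPush].
Qed.

Theorem theorem1 :
  exists g : gnn, poly_time_inference g /\ np_hard (rcw_verification g).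
Proof. by exists rcw_gnn; split; [exact: rcw_gnn_poly_time | exact: rcw_np_hard]. Qed.
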